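(* Let $l(\mathbf{Z}:\boldsymbol\theta)$ be the log-likelihood of the received data $\mathbf{Z}=(\mathbf{Z}_1,\dots,\mathbf{Z}_K)$ in the quantize-and-forward model, and let $I_{s,t}=-E\left[\frac{\partial^2 l(\mathbf{Z}:\boldsymbol\theta)}{\partial\theta_s\,\partial\theta_t}\right]$ be the $(s,t)$ entry of the Fisher information matrix. Then $I_{s,t}$ can be transformed into $$I_{s,t}=-\sum_{k=1}^K\sum_{j=1}^M\left\{\frac{\partial^2p_{k,j}(\boldsymbol\theta)}{\partial\theta_s\,\partial\theta_t}-\sum_{i=1}^M\frac{\partial p_{k,j}(\boldsymbol\theta)}{\partial\theta_s}\frac{\partial p_{k,i}(\boldsymbol\theta)}{\partial\theta_t}\sum_{n=0}^\infty\sum_{m=0}^n(-1)^{m+n}\frac{n!}{m!}\sum_{\substack{\ell_1,\dots,\ell_M\ge0\\ \ell_1+\dots+\ell_M=n-m}}\left[\left(\prod_{v=1}^M\frac{p_{k,v}(\boldsymbol\theta)^{\ell_v}}{\ell_v!}\right)\Lambda_{\boldsymbol\ell}\right]\right\},$$ where the $\ell_v$ range over nonnegative integers, $\boldsymbol\ell=(\ell_1,\dots,\ell_M)$, and $\Lambda_{\boldsymbol\ell}$ (which also depends on $k,j,i$) is given by $$\Lambda_{\boldsymbol\ell}=\int_{\mathbb{R}^\alpha}\frac{\exp\left(-\frac{(\mathbf{z}-\mathbf{b}_j)^T(\mathbf{z}-\mathbf{b}_j)+(\mathbf{z}-\mathbf{b}_i)^T(\mathbf{z}-\mathbf{b}_i)}{2\eta_k^2}\right)}{(2\pi\eta_k^2)^{\alpha/2}}\,\exp\left(-\frac{1}{2\eta_k^2}\sum_{v=1}^M\ell_v(\mathbf{z}-\mathbf{b}_v)^T(\mathbf{z}-\mathbf{b}_v)\right)d\mathbf{z}$$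 $$=\exp\left(-\frac{\left(\mathbf{b}_j+\mathbf{b}_i+\sum_{v=1}^M\ell_v\mathbf{b}_v\right)^T\left(\mathbf{b}_j+\mathbf{b}_i+\sum_{v=1}^M\ell_v\mathbf{b}_v\right)}{2\eta_k^2\sum_{v=1}^M\ell_v+2}\right)\times\frac{\exp\left(-\frac{\mathbf{b}_j^T\mathbf{b}_j+\mathbf{b}_i^T\mathbf{b}_i+\sum_{v=1}^M\ell_v\,\mathbf{b}_v^T\mathbf{b}_v}{2\eta_k^2}\right)}{\sqrt{\sum_{v=1}^M\ell_v+2}}.$$
   Context: Quantize-and-forward model. $K,L\ge1$ are integers, $M=2^{\alpha}$ with $\alpha=\log_2M\ge1$ an integer. $G(x,y:\boldsymbol\theta)$ is a real-valued deterministic field depending on a parameter $\boldsymbol\theta=(\theta_1,\dots,\theta_L)^T$, twice differentiable in $\boldsymbol\theta$; sensors sit at known locations $(x_k,y_k)$, and $G_k=G(x_k,y_k:\boldsymbol\theta)$, $k=1,\dots,K$. Sensor $k$ observes $R_k=G_k+W_k$ with $W_k\sim\mathcal{N}(0,\sigma_k^2)$, $\sigma_k>0$ known. Quantizer: boundaries $-\infty=\tau_1<\tau_2<\dots<\tau_M<\tau_{M+1}=+\infty$. The $j$-th quantization region, between $\tau_j$ and $\tau_{j+1}$, is labelled by a vector $\mathbf{b}_j\in\mathbb{R}^\alpha$ of $\alpha$ bits (the binary representation of the $j$-th level), distinct for distinct $j$. Sensor $k$ sends $\mathbf{B}_k=\mathbf{b}_j$ when $R_k$ lies in the $j$-th region,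 which happens with probability $$p_{k,j}(\boldsymbol\theta)=\int_{\tau_j}^{\tau_{j+1}}\frac{1}{\sqrt{2\pi\sigma_k^2}}\exp\left(-\frac{(t-G_k)^2}{2\sigma_k^2}\right)dt.$$ The fusion center receives $\mathbf{Z}_k=\mathbf{B}_k+\mathbf{N}_k$, where $\mathbf{N}_k\sim\mathcal{N}(\mathbf{0},\eta_k^2I_\alpha)$, $\eta_k>0$ known. All $W_1,\dots,W_K,\mathbf{N}_1,\dots,\mathbf{N}_K$ are mutually independent. The log-likelihood is, up to an additive constant not depending on $\boldsymbol\theta$, $$l(\mathbf{Z}:\boldsymbol\theta)=\sum_{k=1}^K\log\left[\sum_{j=1}^Mp_{k,j}(\boldsymbol\theta)\exp\left(-\frac{(\mathbf{Z}_k-\mathbf{b}_j)^T(\mathbf{Z}_k-\mathbf{b}_j)}{2\eta_k^2}\right)\right],$$ and the expectation in $I_{s,t}$ is with respect to the density of $\mathbf{Z}_k$, $$f_{\mathbf{Z}_k}(\mathbf{z})=\sum_{v=1}^M\frac{p_{k,v}(\boldsymbol\theta)}{(2\pi\eta_k^2)^{\alpha/2}}\exp\left(-\frac{(\mathbf{z}-\mathbf{b}_v)^T(\mathbf{z}-\mathbf{b}_v)}{2\eta_k^2}\right).$$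
   Formalization: The printed closed form of Λ is false (e.g. α=1, i=j, b_j=1, ℓ=0); it is corrected: the first exponent has sign + and denominator 2η_k²(Σℓ_v+2), and the square root of Σℓ_v+2 is raised to the power α. *)

(* Defs.v *)
From HB Require Import structures.
From mathcomp Require Import all_boot all_order all_algebra.
From mathcomp Require Import all_classical all_reals all_analysis.

Set Implicit Arguments.
Unset Strict Implicit.
Unset Printing Implicit Defensive.

Import Order.TTheory GRing.Theory Num.Theory.
Import numFieldNormedType.Exports.

Local Open Scope classical_set_scope.
Local Open Scope ring_scope.

Section tuple_lebesgue.
Context {R : realType}.

(* Lebesgue measure on R^n, by slicing along the first coordinate. *)
Fixpoint tuple_lebesgue (n : nat) : set (n.-tuple R) -> \bar R :=
  match n with
  | 0 => fun A => \d_([tuple] : 0.-tuple R) A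
  | m.+1 => fun A => (\int[lebesgue_measure]_(x in [set: R])
      tuple_lebesgue [set t : m.-tuple R | A [tuple of x :: t]])%E
  end.

Lemma tuple_lebesgue_sigma_finiteP (n : nat) :
  exists m : {sigma_finite_measure set (n.-tuple R) -> \bar R},
    tuple_lebesgue (n := n) = m.
Proof.
elim: n => [|n [m mE]].
  by exists \d_([tuple] : 0.-tuple R).
pose L : {sigma_finite_measure set (measurableTypeR R) -> \bar R} :=
  @lebesgue_measure R.
pose c (xt : measurableTypeR R * n.-tuple R) : n.+1.-tuple R := [tuple of xt.1 :: xt.2].
pose d (u : n.+1.-tuple R) := (thead u : measurableTypeR R, [tuple of behead u]).
have dc xt : d (c xt) = xt.
  by case: xt => x t; congr pair; exact: val_inj.
have mc : measurable_fun setT c by exact: measurable_cons.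
have md : measurable_fun setT d.
  apply/measurable_fun_pairP; split.
    exact: measurable_tnth.
  exact: measurable_behead.
pose prod : {measure set (measurableTypeR R * n.-tuple R)%type -> \bar R} :=
  (L \x m)%E.
pose pf := [the {measure set (n.+1.-tuple R) -> \bar R} of pushforward prod c].
pose q := pf mc.
have sq : sigma_finite setT q.
  have /sigma_finiteP[F [FT ndF Foo]] := sigma_finiteT L.
  have /sigma_finiteP[G [GT ndG Goo]] := sigma_finiteT m.
  exists (fun i => d @^-1` (F i `*` G i)).
    rewrite -preimage_bigcup (_ : \bigcup_i _ = setT) ?preimage_setT//.
    apply/seteqP; split => // -[x t] _.
    have : setT x by []. rewrite FT => -[i _ Fix].
    have : setT t by []. rewrite GT => -[j _ Gjt].
    exists (maxn i j) => //; split => /=.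
    - by move: x Fix; exact/subsetPset/ndF/leq_maxl.
    - by move: t Gjt; exact/subsetPset/ndG/leq_maxr.
  move=> i; have [mFi Fioo] := Foo i; have [mGi Gioo] := Goo i; split.
    by rewrite -[X in measurable X]setTI; apply: md => //; exact: measurableX.
  rewrite /q /pf /= /pushforward /=.
  rewrite (_ : c @^-1` _ = F i `*` G i); last first.
    by apply/seteqP; split=> xt; rewrite /preimage /mkset dc.
  rewrite /prod product_measure1E//.
  by rewrite lte_mul_pinfty// ge0_fin_numE.
pose q' : {sigma_finite_measure set (n.+1.-tuple R) -> \bar R} :=
  HB.pack (q : set _ -> \bar R) q (@Measure_isSigmaFinite.Build _ _ _ q sq).
exists q'; apply/funext => A /=.
rewrite /pushforward /= /product_measure1 mE.
apply: eq_integral => x _ /=; congr (m _).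
by apply/seteqP; split => t; rewrite /xsection /= inE.
Qed.

Section instances.
Variable n : nat.

Let tuple_lebesgue0 : tuple_lebesgue (n := n) set0 = 0%E.
Proof. by have [m ->] := tuple_lebesgue_sigma_finiteP n; exact: measure0. Qed.

Let tuple_lebesgue_ge0 A : (0 <= tuple_lebesgue (n := n) A)%E.
Proof. by have [m ->] := tuple_lebesgue_sigma_finiteP n; exact: measure_ge0. Qed.

Let tuple_lebesgue_sigma_additive : semi_sigma_additive (tuple_lebesgue (n := n)).
Proof.
have [m ->] := tuple_lebesgue_sigma_finiteP n.
exact: measure_semi_sigma_additive.
Qed.

HB.instance Definition _ := isMeasure.Build _ _ _ (tuple_lebesgue (n := n))
  tuple_lebesgue0 tuple_lebesgue_ge0 tuple_lebesgue_sigma_additive.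

Let tuple_lebesgue_sigma_finite : sigma_finite setT (tuple_lebesgue (n := n)).
Proof. by have [m ->] := tuple_lebesgue_sigma_finiteP n; exact: sigma_finiteT. Qed.

HB.instance Definition _ := Measure_isSigmaFinite.Build _ _ _
  (tuple_lebesgue (n := n)) tuple_lebesgue_sigma_finite.

End instances.

End tuple_lebesgue.

Section vectors.
Context {R : realType}.

(* The measurable structure of R^n is on [n.-tuple R], its linear structure is
   on ['rV[R]_n]. *)
Definition rvec (n : nat) (z : n.-tuple R) : 'rV[R]_n := \row_r tnth z r.

Definition sqn (n : nat) (v : 'rV[R]_n) : R := (v *m v^T) 0 0.

Definition partial (L : nat) (s : 'I_L) (f : 'rV[R]_L -> R) : 'rV[R]_L -> R :=
  'D_(delta_mx 0 s) f.

(* Differentiability of the derivative is stated coordinatewise. *)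
Definition twice_differentiable (L : nat) (f : 'rV[R]_L -> R) : Prop :=
  (forall theta, differentiable f theta) /\
  (forall s theta, differentiable (partial s f) theta).

(* Density of the isotropic normal law N(0, eta^2 I) on R^n. *)
Definition normal_vec_pdf (n : nat) (eta : R) (z : n.-tuple R) : R :=
  expR (- sqn (rvec z) / (2 * eta ^+ 2)) / (2 * pi * eta ^+ 2) `^ (n%:R / 2).

End vectors.

(* Mutual independence of the finite family X_1, ..., X_K, Y_1, ..., Y_K, whose
   two halves take values in different spaces; product rules for subfamilies
   are recovered by choosing full sets for the other variables. *)
Definition mutually_independent d d1 d2 (T : measurableType d)
    (T1 : measurableType d1) (T2 : measurableType d2) (R : realType)
    (P : probability T R) (K : nat)
    (X : 'I_K -> {RV P >-> T1}) (Y : 'I_K -> {RV P >-> T2}) : Prop :=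
  forall (A : 'I_K -> set T1) (B : 'I_K -> set T2),
    (forall k, measurable (A k)) -> (forall k, measurable (B k)) ->
    P ((\bigcap_k (X k @^-1` A k)) `&` (\bigcap_k (Y k @^-1` B k))) =
    ((\prod_(k < K) P (X k @^-1` A k)) * \prod_(k < K) P (Y k @^-1` B k))%E.

Section model.
Context {R : realType}.
Variables (K alpha L : nat).
(* Field at the sensor locations, as a function of the parameter. *)
Variable g : 'I_K -> 'rV[R]_L -> R.
Variables (sigma eta : 'I_K -> R).
(* With 0-based indices, region j lies between boundaries j and j + 1. *)
Variable tau : 'I_(2 ^ alpha).+1 -> \bar R.
Variable b : 'I_(2 ^ alpha) -> 'rV[R]_alpha.
Implicit Types (theta : 'rV[R]_L) (k : 'I_K) (i j v : 'I_(2 ^ alpha)).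

Definition boundaries : Prop :=
  [/\ tau ord0 = -oo%E, tau ord_max = +oo%E &
      forall i j : 'I_(2 ^ alpha).+1, (i < j)%N -> (tau i < tau j)%E].

Definition bit_labels : Prop :=
  (forall j r, b j 0 r = 0 \/ b j 0 r = 1) /\ injective b.

Definition region j : set R :=
  [set t | (tau (widen_ord (leqnSn _) j) <= t%:E < tau (lift ord0 j))%E].

Definition quantize (r : R) : 'rV[R]_alpha := \sum_j \1_(region j) r *: b j.

Definition cell_prob k j theta : R :=
  \int[lebesgue_measure]_(t in region j) normal_pdf (g k theta) (sigma k) t.

Definition loglik (Z : 'I_K -> 'rV[R]_alpha) theta : R :=
  \sum_k ln (\sum_j cell_prob k j theta *
                    expR (- sqn (Z k - b j) / (2 * eta k ^+ 2))).

Section fisher.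
Context d (Omega : measurableType d) (P : probability Omega R).
Variables (W : 'I_K -> {RV P >-> R}) (N : 'I_K -> {RV P >-> alpha.-tuple R}).

Definition received theta (omega : Omega) k : 'rV[R]_alpha :=
  quantize (g k theta + W k omega) + rvec (N k omega).

(* The law of the data is the one at the point where the log-likelihood is
   differentiated. *)
Definition loglik_hessian theta (s t : 'I_L) (omega : Omega) : R :=
  partial s (partial t (loglik (received theta omega))) theta.

Definition fisher_information theta (s t : 'I_L) : \bar R :=
  (- 'E_P[loglik_hessian theta s t])%E.

End fisher.

Definition Lambda k j i (l : 'I_(2 ^ alpha) -> nat) : R :=
  \int[@tuple_lebesgue R alpha]_z
    (expR (- (sqn (rvec z - b j) + sqn (rvec z - b i)) / (2 * eta k ^+ 2)) /
       (2 * pi * eta k ^+ 2) `^ (alpha%:R / 2) *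
     expR (- (1 / (2 * eta k ^+ 2)) *
           \sum_v (l v)%:R * sqn (rvec z - b v))).

(* The n-th term of the outer series; a multi-index with sum n - m has all its
   entries in {0, ..., n - m}. *)
Definition series_term theta k j i (n : nat) : R :=
  \sum_(m < n.+1) (-1) ^+ (m + n) * (n`!%:R / m`!%:R) *
    \sum_(l : {ffun 'I_(2 ^ alpha) -> 'I_(n - m).+1}
          | (\sum_v (l v : nat) == n - m)%N)
      ((\prod_v (cell_prob k v theta ^+ l v / (l v)`!%:R)) * Lambda k j i (fun v => l v)).

End model.

(* Main.v *)
Require Import Defs.
From HB Require Import structures.
From mathcomp Require Import all_boot all_order all_algebra.
From mathcomp Require Import all_classical all_reals all_analysis.
From mathcomp Require Import measurable_realfun.
From mathcomp Require Import ring lra.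

(* Put D(z) = sum_v p_v exp(-|z - b_v|^2 / (2 eta^2)), which lies in (0, 1], so
   that the density of Z_k is D / c with c = (2 pi eta^2)^(alpha/2).
   Differentiating log D twice gives the second derivatives of the p_j against
   w_j / D, where w_j is the j-th exponential, minus the products of first
   derivatives against w_j w_i / D^2.  Under the law of Z_k the former has mean
   1 and the latter has mean the integral of w_j w_i / (c D).  Expanding
   1/D = sum_n (1 - D)^n, then (1 - D)^n by the binomial theorem and the powers
   of D by the multinomial theorem, gives the series; as p_j w_j <= D, the
   partial sums are dominated by w_i / (c p_j), hence term-by-term integration
   is legitimate.  Each Lambda is a Gaussian integral, computed by completing
   the square. *)

Set Implicit Arguments.
Unset Strict Implicit.
Unset Printing Implicit Defensive.

Import Order.TTheory GRing.Theory Num.Theory.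
Import numFieldNormedType.Exports.

Local Open Scope classical_set_scope.
Local Open Scope ring_scope.

(** * Multinomial expansion *)

Section multinomial.
Variable R : numFieldType.

Definition exp_poly (n : nat) (a : R) : {poly R} :=
  \poly_(i < n.+1) (a ^+ i / i`!%:R).

(* Comparing the coefficients of 'X^n in a product of truncated exponentials
   turns the multinomial theorem into an induction on the binomial one. *)
Lemma coef_prod_exp_poly (I : Type) (r : seq I) (n k : nat) (a : I -> R) :
  (k <= n)%N ->
  (\prod_(i <- r) exp_poly n (a i))`_k = (\sum_(i <- r) a i) ^+ k / k`!%:R.
Proof.
elim: r k => [|i r IH] k kn.
  by rewrite !big_nil coef1 expr0n; case: k kn => [|k] _; rewrite ?divr1 ?mul0r.
rewrite !big_cons coefM addrC exprDn mulr_suml.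
apply: eq_bigr => -[j /= jk] _; rewrite ltnS in jk.
rewrite coef_poly ltnS (leq_trans jk kn) IH ?(leq_trans (leq_subr _ _))//.
rewrite -[_ *+ _]mulr_natr -(bin_fact jk) !natrM.
have nz m : (m`!%:R : R) != 0 by rewrite pnatr_eq0 -lt0n fact_gt0.
have bz : ('C(k, j)%:R : R) != 0 by rewrite pnatr_eq0 -lt0n bin_gt0.
by field; rewrite bz !nz.
Qed.

(** Distributing the product chooses one monomial per factor, that is a function [l]; reading off a
    coefficient keeps those of the right total degree. This turns a constrained sum over
    multi-indices into a coefficient extraction. *)
Lemma coef_prod_poly_sum (I : finType) (n : nat) (c : I -> nat -> R) (k : nat) :
  (\prod_i \poly_(j < n.+1) c i j)`_k =
  \sum_(l : {ffun I -> 'I_n.+1} | (\sum_i (l i : nat) == k)%N)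
     \prod_i c i (l i).
Proof.
under eq_bigr do rewrite poly_def.
rewrite bigA_distr_bigA /= coef_sum [RHS]big_mkcond /=.
apply: eq_bigr => l _.
under eq_bigr do rewrite -mul_polyC.
rewrite big_split /= -rmorph_prod /= prodrXr coefCM coefXn eq_sym.
by case: eqP => _; rewrite ?mulr1 ?mulr0.
Qed.

Lemma multinomial_ffun (I : finType) (n : nat) (a : I -> R) :
  \sum_(l : {ffun I -> 'I_n.+1} | (\sum_i (l i : nat) == n)%N)
     \prod_i (a i ^+ l i / (l i)`!%:R) =
  (\sum_i a i) ^+ n / n`!%:R.
Proof.
by rewrite -(coef_prod_poly_sum _ (fun i j => a i ^+ j / j`!%:R)) coef_prod_exp_poly.
Qed.

(* The right-hand side has the shape of [series_term]. *)
Lemma expr_1B_multinomial (I : finType) (n : nat) (a : I -> R) :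
  (1 - \sum_i a i) ^+ n =
  \sum_(m < n.+1) (-1) ^+ (m + n) * (n`!%:R / m`!%:R) *
    \sum_(l : {ffun I -> 'I_(n - m).+1} | (\sum_i (l i : nat) == n - m)%N)
      \prod_i (a i ^+ l i / (l i)`!%:R).
Proof.
rewrite addrC exprDn.
apply: eq_bigr => -[m /= mn] _; rewrite ltnS in mn.
rewrite multinomial_ffun expr1n mulr1 (exprNn (\sum_i a i)) -[_ *+ _]mulr_natr -(bin_fact mn) !natrM.
have -> : (-1) ^+ (n - m) = (-1) ^+ (m + n) :> R.
  by rewrite -signr_odd oddB// -[RHS]signr_odd oddD addbC.
have nz k : (k`!%:R : R) != 0 by rewrite pnatr_eq0 -lt0n fact_gt0.
by field; rewrite !nz.
Qed.

End multinomial.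

(** * Lebesgue measure on tuples *)

Section tuple_lebesgue_theory.
Context {R : realType}.
Local Notation mu := (@lebesgue_measure R).
Local Notation tl := (@tuple_lebesgue R _).

(** The pushforward by a translation gives half-open intervals their length, which characterises
    Lebesgue measure. *)
Lemma lebesgue_measure_shift (c : R) (A : set R) : measurable A ->
  mu ((fun x => x + c) @^-1` A) = mu A.
Proof.
move=> mA; apply/esym.
have mc : measurable_fun setT (fun x : measurableTypeR R => x + c : measurableTypeR R).
  by apply: measurable_funD.
pose m := [the {measure set (measurableTypeR R) -> \bar R} of
  pushforward (@lebesgue_measure R : {measure set (measurableTypeR R) -> \bar R})
   (fun x : measurableTypeR R => x + c : measurableTypeR R)].
pose m' := m mc.
rewrite (@lebesgue_measure_unique R m')//.
move=> _ [[a b] _ <-] /=; rewrite /m'/= /pushforward.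
rewrite (_ : _ @^-1` _ = `]a - c, b - c]%classic); last first.
  by apply/seteqP; split => x /=; rewrite !in_itv/= ltrBlDr lerBrDr.
rewrite !lebesgue_measure_itv/= !lte_fin ltrD2r.
by case: ifP => // _; rewrite -!EFinB; congr EFin; ring.
Qed.

Lemma ge0_integral_shift (c : R) (f : R -> \bar R) :
  measurable_fun setT f -> (forall x, (0 <= f x)%E) ->
  (\int[mu]_x f ((x : R) + c)%R = \int[mu]_x f x)%E.
Proof.
move=> mf f0.
have mc : measurable_fun setT (fun x : measurableTypeR R => x + c : measurableTypeR R).
  by apply: measurable_funD.
have := @ge0_integral_pushforward _ _ _ _ R _ mc
  (@lebesgue_measure R : {measure set (measurableTypeR R) -> \bar R}) setT f
  measurableT mf (fun x _ => f0 x).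
rewrite preimage_setT => <-.
apply: eq_measure_integral => A mA _; exact: lebesgue_measure_shift.
Qed.

(** Tonelli: slicing along the first coordinate computes the product measure of sections, so the
    measure in dimension [n.+1] is the pushforward of a product measure by cons. *)
Lemma ge0_integral_tuple_lebesgueS n (f : n.+1.-tuple R -> \bar R) :
  measurable_fun setT f -> (forall t, (0 <= f t)%E) ->
  (\int[tl]_t f t = \int[mu]_x \int[tl]_t f [tuple of x :: t])%E.
Proof.
move=> mf f0.
pose L : {sigma_finite_measure set (measurableTypeR R) -> \bar R} :=
  @lebesgue_measure R.
pose c (xt : measurableTypeR R * n.-tuple R) : n.+1.-tuple R := [tuple of xt.1 :: xt.2].
have mc : measurable_fun setT c by exact: measurable_cons.
pose prod : {measure set (measurableTypeR R * n.-tuple R)%type -> \bar R} :=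
  (L \x (@tuple_lebesgue R n))%E.
transitivity (\int[pushforward prod c]_t f t)%E.
  apply: eq_measure_integral => A mA _ /=.
  rewrite /pushforward /= /product_measure1.
  apply: eq_integral => x _ /=; congr (tuple_lebesgue _).
  by apply/seteqP; split => t; rewrite /xsection /= inE.
rewrite ge0_integral_pushforward//= preimage_setT.
rewrite fubini_tonelli1//=; exact: measurableT_comp.
Qed.

Definition tshift n (a : 'I_n -> R) (t : n.-tuple R) : n.-tuple R :=
  [tuple tnth t i + a i | i < n].

Lemma tnth_tshift n (a : 'I_n -> R) t i : tnth (tshift a t) i = tnth t i + a i.
Proof. by rewrite tnth_mktuple. Qed.

Lemma tshift_cons n (a : 'I_n.+1 -> R) x (t : n.-tuple R) :
  tshift a [tuple of x :: t] =
  [tuple of (x + a ord0) :: tshift (fun i => a (lift ord0 i)) t].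
Proof.
apply: eq_from_tnth => i; rewrite tnth_tshift.
by case: (unliftP ord0 i) => [j ->|->]; rewrite ?tnthS ?tnth0// tnth_tshift.
Qed.

Lemma measurable_tshift n (a : 'I_n -> R) : measurable_fun setT (tshift a).
Proof.
apply/measurable_fun_tnthP => i.
rewrite (_ : _ \o _ = fun t => tnth t i + a i); last first.
  by apply/funext => t /=; rewrite tnth_tshift.
by apply: measurable_funD => //; exact: measurable_tnth.
Qed.

(** Induction on the dimension: Tonelli splits off the head, the induction hypothesis translates the
    tail at a fixed head, and invariance on the line translates the head. *)
Lemma ge0_integral_tshift n (a : 'I_n -> R) (f : n.-tuple R -> \bar R) :
  measurable_fun setT f -> (forall x, (0 <= f x)%E) ->
  (\int[tl]_x f (tshift a x) = \int[tl]_x f x)%E.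
Proof.
elim: n a f => [|n IH] a f mf f0.
  by apply: eq_integral => x _; rewrite [tshift a x]tuple0 [x]tuple0.
rewrite ge0_integral_tuple_lebesgueS//; last first.
  by apply: measurableT_comp mf _; exact: measurable_tshift.
rewrite [RHS]ge0_integral_tuple_lebesgueS//.
have mfx x : measurable_fun setT (fun t : n.-tuple R => f [tuple of x :: t]).
  by apply: measurableT_comp mf _; exact: measurable_cons.
under eq_integral.
  move=> x _.
  under eq_integral do rewrite tshift_cons.
  rewrite (IH _ (fun t => f [tuple of x + a ord0 :: t]))//.
  over.
rewrite (ge0_integral_shift (a ord0) (f := fun x => \int[tl]_t f [tuple of x :: t])%E)//.
- pose g (xt : measurableTypeR R * n.-tuple R) := f [tuple of xt.1 :: xt.2].
  apply: (@measurable_fun_fubini_tonelli_F _ _ _ _ _ (@tuple_lebesgue R n) g).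
    by apply: measurableT_comp mf _; exact: measurable_cons.
  by move=> x; exact: f0.
- by move=> x; apply: integral_ge0.
Qed.

Lemma ge0_integral_prod_tuple n (g : 'I_n -> R -> R) :
  (forall i, measurable_fun setT (g i)) -> (forall i x, 0 <= g i x) ->
  (\int[tl]_t (\prod_i g i (tnth t i))%:E = \prod_i \int[mu]_x (g i x)%:E)%E.
Proof.
elim: n g => [|n IH] g mg g0.
  rewrite big_ord0.
  under eq_integral do rewrite big_ord0.
  by rewrite integral_cst// mul1e /= diracE in_setT.
(* The dimension is general, to cover both the full product and the product over the tail. *)
have mpr m (h : 'I_m -> R -> R) : (forall i, measurable_fun setT (h i)) ->
    measurable_fun setT (fun t : m.-tuple R => \prod_i h i (tnth t i)).
  move=> mh; apply: measurable_prod => i _.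
  by apply: measurableT_comp (mh i) _; exact: measurable_tnth.
rewrite ge0_integral_tuple_lebesgueS//; last 2 first.
- by apply/measurable_EFinP; exact: mpr.
- by move=> t; rewrite lee_fin prodr_ge0.
under eq_integral.
  move=> x _.
  under eq_integral.
    move=> t _.
    rewrite big_ord_recl tnth0 EFinM.
    under eq_bigr do rewrite tnthS.
    over.
  rewrite ge0_integralZl//; last 3 first.
  - by apply/measurable_EFinP; apply: (mpr _ (fun i => g (lift ord0 i))).
  - by move=> t _; rewrite lee_fin prodr_ge0.
  - by rewrite lee_fin.
  rewrite (IH (fun i => g (lift ord0 i)))//.
  over.
rewrite ge0_integralZr//; last 3 first.
- by apply/measurable_EFinP; exact: mg.
- by move=> x _; rewrite lee_fin.
- by apply: prode_ge0 => i _; apply: integral_ge0 => x _; rewrite lee_fin.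
by rewrite big_ord_recl.
Qed.

Lemma sqnE n (v : 'rV[R]_n) : sqn v = \sum_i v 0 i ^+ 2.
Proof. by rewrite /sqn mxE; apply: eq_bigr => i _; rewrite mxE expr2. Qed.

(** The power n/2 is the n-th power of a square root, so the normalising constant splits over the
    coordinates just as the exponential does. *)
Lemma normal_vec_pdfE n (s : R) (z : n.-tuple R) : 0 < s ->
  normal_vec_pdf s z = \prod_i normal_pdf 0 s (tnth z i).
Proof.
move=> s0.
have c0 : 0 <= s ^+ 2 * pi *+ 2 by rewrite mulrn_wge0// mulr_ge0 ?sqr_ge0 ?pi_ge0.
under eq_bigr do rewrite normal_pdfE ?gt_eqF//.
rewrite big_split/= prodr_const card_ord mulrC /normal_vec_pdf; congr (_ * _).
  rewrite /normal_fun -expR_sum; congr expR.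
  rewrite sqnE -sumrN mulr_suml; apply: eq_bigr => i _.
  by rewrite mxE subr0 mulr_natl.
rewrite /normal_peak exprVn; congr (_^-1).
rewrite (_ : 2 * pi * s ^+ 2 = s ^+ 2 * pi *+ 2); last by ring.
by rewrite [n%:R / 2]mulrC powRrM powR12_sqrt// powR_mulrn ?sqrtr_ge0.
Qed.

Lemma measurable_sqn n (a : 'rV[R]_n) :
  measurable_fun setT (fun z : n.-tuple R => sqn (rvec z - a)).
Proof.
under eq_fun do rewrite sqnE.
apply: measurable_sum => i; apply: measurable_funX.
under eq_fun do rewrite !mxE.
by apply: measurable_funB => //; exact: measurable_tnth.
Qed.

Lemma measurable_expR_sqn n (a : 'rV[R]_n) (c : R) :
  measurable_fun setT (fun z : n.-tuple R => expR (- sqn (rvec z - a) / c)).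
Proof.
apply: measurableT_comp => //; apply: measurable_funM => //.
by apply: measurableT_comp => //; exact: measurable_sqn.
Qed.

Lemma rvec_tshift n (a : 'rV[R]_n) z :
  rvec (tshift (fun i => a 0 i) z) = rvec z + a.
Proof. by apply/rowP => i; rewrite !mxE tnth_tshift. Qed.

(** Translation centres the density at 0, where it is a product of one-dimensional densities of mass
    1. *)
Lemma integral_gauss_vec n (s : R) (a : 'rV[R]_n) : 0 < s ->
  (\int[tl]_z (expR (- sqn (rvec z - a) / (2 * s ^+ 2)) /
     (2 * pi * s ^+ 2) `^ (n%:R / 2))%:E = 1)%E.
Proof.
move=> s0.
rewrite -(@ge0_integral_tshift _ (fun i => a 0 i))/=; last 2 first.
- by apply/measurable_EFinP/measurable_funM => //; exact: measurable_expR_sqn.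
- by move=> z; rewrite lee_fin divr_ge0 ?expR_ge0 ?powR_ge0.
under eq_integral.
  move=> z _; rewrite rvec_tshift addrK -/(normal_vec_pdf s z) normal_vec_pdfE//.
  over.
rewrite (@ge0_integral_prod_tuple _ (fun=> normal_pdf 0 s)).
- by rewrite big1// => i _; rewrite integral_normal_pdf.
- by move=> i; exact: measurable_normal_pdf.
- by move=> i x; exact: normal_pdf_ge0.
Qed.

End tuple_lebesgue_theory.

(** * Gaussian cell probabilities *)

Section derive_comp.
Context {R : realType} {V : normedModType R}.

Lemma derive_comp (g : V -> R) (F : R -> R) x v :
  differentiable g x -> derivable F (g x) 1 ->
  'D_v (F \o g) x = 'D_1 F (g x) * 'D_v g x.
Proof.
move=> dg /derivable1_diffP dF.
rewrite !deriveE//; last exact: differentiable_comp.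
by rewrite diff_comp//= -[X in 'd F _ X]mulr1 -[X in 'd F _ X]/(_ *: _) linearZ mulrC.
Qed.

End derive_comp.

Section normal_cells.
Context {R : realType}.
Local Notation mu := (@lebesgue_measure R).
Implicit Types (s m : R) (c : \bar R).

Lemma normal_pdf_shift s m t : s != 0 -> normal_pdf m s (t + m) = normal_pdf 0 s t.
Proof. by move=> s0; rewrite !normal_pdfE// /normal_fun addrK subr0. Qed.

Lemma normal_pdf_gt0 s m t : s != 0 -> 0 < normal_pdf m s t.
Proof.
by move=> s0; rewrite normal_pdfE// mulr_gt0 ?normal_peak_gt0 ?expR_gt0.
Qed.

Lemma normal_prob_shift s m (A : set R) : s != 0 -> measurable A ->
  normal_prob 0 s ((fun w => w + m) @^-1` A) = normal_prob m s A.
Proof.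
move=> s0 mA; rewrite /normal_prob [LHS]integral_mkcond [RHS]integral_mkcond.
set f := (EFin \o normal_pdf m s) \_ A.
rewrite -(ge0_integral_shift m (f := f)).
- apply: eq_integral => x _; rewrite /f !patchE /= normal_pdf_shift//.
- apply/(measurable_restrictT _ mA)/measurable_funTS/measurable_EFinP.
  exact: measurable_normal_pdf.
- by move=> x; apply: erestrict_ge0 => y _; rewrite lee_fin normal_pdf_ge0.
Qed.

Lemma measurable_lt_ereal c : measurable [set t : R | (t%:E < c)%E].
Proof.
case: c => [r| |].
- have -> : [set t : R | (t%:E < r%:E)%E] = `]-oo, r[%classic.
    by apply/seteqP; split => t /=; rewrite in_itv/= lte_fin.
  exact: measurable_itv.
- have -> : [set t : R | (t%:E < +oo)%E] = setT.
    by apply/seteqP; split => t // _; rewrite /mkset ltry.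
  exact: measurableT.
- have -> : [set t : R | (t%:E < -oo)%E] = set0.
    by apply/seteqP; split => t //; rewrite /mkset ltNge leNye.
  exact: measurable0.
Qed.

Lemma measurable_cell (a b : \bar R) : measurable [set t : R | (a <= t%:E < b)%E].
Proof.
rewrite (_ : mkset _ = [set t : R | (t%:E < b)%E] `\` [set t : R | (t%:E < a)%E]).
  by apply: measurableD; exact: measurable_lt_ereal.
apply/seteqP; split => t /=; first by move=> /andP[ab ->]; rewrite ltNge ab.
by move=> [-> /negP]; rewrite -leNgt => ->.
Qed.

(** A normal distribution function seen as a function of the mean, the only quantity through which
    theta enters; the threshold is extended so as to include the two infinite boundaries. *)
Definition ncdf s c m : R := fine (normal_prob m s [set t | (t%:E < c)%E]).

Lemma normal_prob_cell s m (a b : \bar R) : (a <= b)%E ->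
  fine (normal_prob m s [set t | (a <= t%:E < b)%E]) = ncdf s b m - ncdf s a m.
Proof.
move=> ab; rewrite /ncdf.
have -> : [set t | (t%:E < b)%E] =
    [set t | (a <= t%:E < b)%E] `|` [set t : R | (t%:E < a)%E].
  apply/seteqP; split => t /=.
    by move=> ->; rewrite andbT; case: leP => _; [left|right].
  by move=> [/andP[]//|/lt_le_trans]; exact.
rewrite measureU//; last 3 first.
- exact: measurable_cell.
- exact: measurable_lt_ereal.
- apply/seteqP; split => t //= -[/andP[at_ _]].
  by rewrite ltNge at_.
have mC := measurable_cell a b; have mL := measurable_lt_ereal a.
(* With implicit arguments, [fineD] would unify with the difference that defines
   the integral. *)
rewrite (@fineD _ (normal_prob m s _) (normal_prob m s _)) ?addrK//;
  exact: fin_num_measure.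
Qed.

(** The cell contains an interval of positive length. Were its probability zero, the density would
    vanish almost everywhere on the cell; being positive everywhere, it would force that interval
    into a null set. *)
Lemma normal_prob_cell_gt0 s m (a b : \bar R) : s != 0 -> (a < b)%E ->
  0 < fine (normal_prob m s [set t | (a <= t%:E < b)%E]).
Proof.
move=> s0 ab; set A := mkset _.
have mA : measurable A by exact: measurable_cell.
have [u [v [uv uvA]]] : exists u v : R, u < v /\ `[u, v[%classic `<=` A.
  rewrite /A; clear A mA.
  case: a b ab => [a| |] [b| |]//=.
  - by rewrite lte_fin => ab; exists a, b; split => // x /=; rewrite in_itv/= lee_fin lte_fin.
  - move=> _; exists a, (a + 1); split; first by rewrite ltrDl.
    by move=> x /=; rewrite in_itv/= lee_fin ltry andbT => /andP[].
  - move=> _; exists (b - 1), b; split; first by rewrite ltrBlDr ltrDl.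
    by move=> x /=; rewrite in_itv/= lte_fin leNye => /andP[].
  - by move=> _; exists 0, 1; split => // x _ /=; rewrite leNye ltry.
rewrite lt_neqAle fine_ge0// andbT eq_sym; apply/eqP => A0.
have {}A0 : normal_prob m s A = 0%E.
  by rewrite -[LHS]fineK ?fin_num_measure// A0.
have mf : measurable_fun A (EFin \o normal_pdf m s).
  by apply/measurable_funTS/measurable_EFinP; exact: measurable_normal_pdf.
have /(ae_eq_integral_abs mu mA mf)[N [mN N0 AN]] :
    (\int[mu]_(x in A) `|(EFin \o normal_pdf m s) x| = 0)%E.
  rewrite -[RHS]A0; apply: eq_integral => x _ /=.
  by rewrite ger0_norm// normal_pdf_ge0.
have : (mu `[u, v[%classic <= mu N)%E.
  apply: le_measure; rewrite ?inE// => x /uvA Ax.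
  apply: AN => /= /(_ Ax) [/eqP].
  by rewrite gt_eqF// normal_pdf_gt0.
by rewrite N0 lebesgue_measure_itv/= lte_fin uv -EFinB lee_fin leNgt subr_gt0 uv.
Qed.

Definition normal_cdf0 s x : R := \int[mu]_(t in `]-oo, x]) normal_pdf 0 s t.

(** Translation moves the mean into the upper limit of integration, where the fundamental theorem of
    calculus can differentiate it. The open ray may be closed because a point is null. *)
Lemma ncdf_EFin s r m : s != 0 -> ncdf s r%:E m = normal_cdf0 s (r - m).
Proof.
move=> s0; rewrite /ncdf -normal_prob_shift//; last exact: measurable_lt_ereal.
rewrite /normal_cdf0 -Rintegral_itv_bndo_bndc; last first.
  by apply: integrableS (integrable_normal_pdf 0 s).
rewrite /normal_prob /Rintegral; congr (fine (integral _ _ _)).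
by apply/seteqP; split => w /=; rewrite in_itv/= lte_fin ltrBrDr.
Qed.

Lemma is_derive_normal_cdf0 s (x : R) : s != 0 ->
  is_derive x 1 (normal_cdf0 s) (normal_pdf 0 s x).
Proof.
move=> s0.
(* The fundamental theorem needs [x] strictly inside the domain of integrability; [x + 1] is an
   arbitrary right end. *)
have xx1 : x < x + 1 by rewrite ltrDl.
have fi : mu.-integrable `]-oo, x + 1] (EFin \o normal_pdf 0 s).
  by apply: integrableS (integrable_normal_pdf 0 s).
have := @continuous_FTC1 R (normal_pdf 0 s) -oo%O x _ xx1 fi; rewrite /= ltNyr.
move=> /(_ isT (continuous_normal_pdf s0 (x := x)))[dF F'E].
by rewrite -F'E derive1E; exact: DeriveDef.
Qed.

Lemma derivable_normal_pdf s (x : R) : s != 0 -> derivable (normal_pdf 0 s) x 1.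
Proof.
move=> s0.
have -> : normal_pdf 0 s = normal_peak s \*: (expR \o
    ((- (s ^+ 2 *+ 2)^-1) \*: (@id R ^+ 2))).
  apply/funext => y; rewrite normal_pdfE//=; congr (_ * expR _).
  by rewrite subr0 mulNr mulrC -mulNr.
apply: derivableZ; apply: diff_derivable; apply: differentiable_comp.
  by apply/derivable1_diffP; apply: ex_derive.
by apply/derivable1_diffP; exact: derivable_expR.
Qed.

(** For a finite threshold the derivative in the mean is minus a Gaussian density, again
    differentiable; for infinite thresholds the function is constant, 1 or 0. *)
Lemma derivable_ncdf s c : s != 0 ->
  (forall m : R, derivable (ncdf s c) m 1) /\
  (forall m : R, derivable ('D_1 (ncdf s c)) m 1).
Proof.
move=> s0.
have cstP (k : R) : (forall m : R, derivable (cst k : R -> R) m 1) /\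
  (forall m : R, derivable ('D_1 (cst k : R -> R)) m 1).
  split => m; first exact: derivable_cst.
  have -> : 'D_1 (cst k : R -> R) = cst 0.
    by apply/funext => z; exact: derive_cst.
  exact: derivable_cst.
case: c => [r| |].
- have E : ncdf s r%:E = normal_cdf0 s \o (cst r - id).
    by apply/funext => m; rewrite ncdf_EFin.
  have dB (m : R) : differentiable (cst r - @id R) m.
    by apply: differentiableB.
  have DB (m : R) : 'D_1 (cst r - @id R) m = -1.
    by rewrite deriveB// derive_cst derive_id sub0r.
  have dPhi (x : R) : derivable (normal_cdf0 s) x 1.
    by have [] := is_derive_normal_cdf0 x s0.
  have DE : 'D_1 (ncdf s r%:E) = (-1) \*: (normal_pdf 0 s \o (cst r - id)).
    apply/funext => m; rewrite E derive_comp// DB mulrC.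
    by have [_ ->] := is_derive_normal_cdf0 (r - m) s0.
  rewrite DE E; split=> m.
    by apply: diff_derivable; apply: differentiable_comp => //; apply/derivable1_diffP.
  apply: derivableZ; apply: diff_derivable; apply: differentiable_comp => //.
  by apply/derivable1_diffP; exact: derivable_normal_pdf.
- rewrite (_ : ncdf s +oo%E = cst 1)//; apply/funext => m.
  rewrite /ncdf (_ : mkset _ = setT) ?probability_setT//.
  by apply/seteqP; split => t // _; rewrite /mkset ltry.
- rewrite (_ : ncdf s -oo%E = cst 0)//; apply/funext => m.
  rewrite /ncdf (_ : mkset _ = set0) ?measure0//.
  by apply/seteqP; split => t //; rewrite /mkset ltNge leNye.
Qed.

End normal_cells.

(** * Densities and means *)

Section density.
Local Open Scope ereal_scope.
Context d (T : measurableType d) (R : realType).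
Variables (mu nu : {measure set T -> \bar R}) (rho : T -> R).
Hypotheses (mrho : measurable_fun setT rho) (rho0 : forall x, (0 <= rho x)%R)
  (nuE : forall A, measurable A -> nu A = \int[mu]_(x in A) (rho x)%:E).

Import HBNNSimple.

(** The hypothesis on sets gives the claim for indicators, linearity extends it to simple functions,
    and monotone convergence on both sides to nonnegative measurable functions. *)
Lemma ge0_integral_density (f : T -> \bar R) :
  measurable_fun setT f -> (forall x, 0 <= f x) ->
  \int[nu]_x f x = \int[mu]_x (f x * (rho x)%:E).
Proof.
move=> mf f0; pose h := nnsfun_approx measurableT mf.
have hf x : (h n x)%:E @[n --> \oo] --> f x by exact: cvg_nnsfun_approx.
have ndh x : {homo (fun n => (h n x)%:E) : a b / (a <= b)%N >-> a <= b}.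
  by move=> a b ab; rewrite lee_fin; exact/lefP/nd_nnsfun_approx.
have mh n : measurable_fun setT (fun x => (h n x)%:E) by exact/measurable_EFinP.
have -> : \int[nu]_x f x = limn (fun n => \int[nu]_x (h n x)%:E).
  under eq_integral do rewrite -(cvg_lim _ (hf _))//.
  by apply: monotone_convergence => // n x _; rewrite lee_fin.
have -> : \int[mu]_x (f x * (rho x)%:E) =
    limn (fun n => \int[mu]_x ((h n x)%:E * (rho x)%:E)).
  have hfr x : f x * (rho x)%:E = limn (fun n => (h n x)%:E * (rho x)%:E).
    by apply/esym/cvg_lim => //; apply: cvgeZr.
  under eq_integral do rewrite hfr.
  apply: monotone_convergence => //.
  - by move=> n; apply: emeasurable_funM => //; exact/measurable_EFinP.
  - by move=> n x _; rewrite mule_ge0 ?lee_fin.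
  - by move=> x _ a b ab; rewrite lee_wpmul2r ?lee_fin//; exact: ndh.
congr (limn _); apply/funext => n.
have mI r : measurable_fun setT (fun x => (r * \1_(h n @^-1` [set r]) x)%:E).
  by apply/measurable_EFinP; exact: measurable_funM.
have E x : (h n x)%:E = \sum_(y \in range (h n)) (y * \1_(h n @^-1` [set y]) x)%:E.
  by rewrite [in LHS]fimfunE -fsumEFin.
under eq_integral do rewrite E.
rewrite ge0_integral_fsum//; last by move=> y x _; exact: nnfun_muleindic_ge0.
under [RHS]eq_integral.
  move=> x _; rewrite E ge0_mule_fsuml; last by move=> y; exact: nnfun_muleindic_ge0.
  over.
rewrite ge0_integral_fsum//; last 2 first.
- by move=> y; apply: emeasurable_funM => //; exact/measurable_EFinP.
- by move=> y x _; rewrite mule_ge0 ?lee_fin//; exact: nnfun_muleindic_ge0.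
apply: eq_fsbigr => r rh.
under eq_integral do rewrite EFinM.
rewrite integralZl_indic_nnsfun// integral_indic// setIT nuE//.
under [RHS]eq_integral do rewrite EFinM -muleA.
rewrite ge0_integralZl//; last 3 first.
- by apply: emeasurable_funM; exact/measurable_EFinP.
- by move=> x _; rewrite mule_ge0 ?lee_fin.
- by move: rh; rewrite inE => -[x _ <-]; rewrite lee_fin.
congr (_ * _); rewrite integral_mkcond; apply: eq_integral => x _.
by rewrite patchE indicE; case: (x \in _); rewrite ?mul1e ?mul0e.
Qed.

End density.

Section has_mean.
Context d (T : measurableType d) (R : realType) (P : {measure set T -> \bar R}).

(** Integrability is kept together with the value, since linearity of the integral requires it;
    means can then be assembled along the structure of a formula. The measure need not be a
    probability: Lebesgue measure is used as well. *)
Definition has_mean (X : T -> R) (e : R) : Prop :=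
  P.-integrable setT (EFin \o X) /\ (\int[P]_x (X x)%:E = e%:E)%E.

Lemma eq_has_mean (X Y : T -> R) e : X =1 Y -> has_mean X e -> has_mean Y e.
Proof. by move=> /funext ->. Qed.

Lemma has_meanZ (c : R) (X : T -> R) e : has_mean X e -> has_mean (fun x => c * X x) (c * e).
Proof.
move=> [iX EX]; split.
  by apply: eq_integrable (integrableZl measurableT c iX).
under eq_integral do rewrite EFinM.
by rewrite integralZl// EX.
Qed.

Lemma has_meanB X Y e f : has_mean X e -> has_mean Y f ->
  has_mean (fun x => X x - Y x) (e - f).
Proof.
move=> [iX EX] [iY EY]; split.
  by apply: eq_integrable (integrableB measurableT iX iY).
under eq_integral do rewrite EFinB.
by rewrite (integralB_EFin measurableT iX iY) EX EY.
Qed.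

Lemma has_mean_sum (I : finType) (Q : pred I) (X : I -> T -> R) (e : I -> R) :
  (forall i, has_mean (X i) (e i)) ->
  has_mean (fun x => \sum_(i | Q i) X i x) (\sum_(i | Q i) e i).
Proof.
move=> XE; have iX i : P.-integrable setT (EFin \o X i) := (XE i).1.
split.
  apply: eq_integrable (integrable_sum measurableT (index_enum _) (fun i _ => iX i)) => //.
  by move=> x _ /=; rewrite sumEFin.
under eq_integral do rewrite -sumEFin.
rewrite integral_sum//.
by rewrite -sumEFin; apply: eq_bigr => i _; rewrite (XE i).2.
Qed.

Lemma ge0_has_mean (X : T -> R) e : measurable_fun setT X -> (forall x, 0 <= X x) ->
  (\int[P]_x (X x)%:E = e%:E)%E -> has_mean X e.
Proof.
move=> mX X0 EX; split => //; apply/integrableP; split; first exact/measurable_EFinP.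
under eq_integral do rewrite /= ger0_norm//.
by rewrite EX ltry.
Qed.

End has_mean.

(** * Second derivatives of log-mixtures *)

Section hessian.
Context {R : realType} {L : nat}.
Local Notation V := 'rV[R]_L.
Implicit Types (theta v : V) (s t : 'I_L).

Lemma twice_differentiable_comp (F : R -> R) (g : V -> R) :
  (forall m : R, derivable F m 1) -> (forall m : R, derivable ('D_1 F) m 1) ->
  twice_differentiable g -> twice_differentiable (F \o g).
Proof.
move=> dF d2F [dg d2g]; split=> [theta|s theta].
  by apply: differentiable_comp => //; exact/derivable1_diffP.
have -> : partial s (F \o g) = ('D_1 F \o g) * partial s g.
  by apply/funext => z; rewrite /partial derive_comp.
by apply: differentiableM => //; apply: differentiable_comp => //; exact/derivable1_diffP.
Qed.

Lemma twice_differentiableB (f g : V -> R) :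
  twice_differentiable f -> twice_differentiable g -> twice_differentiable (f - g).
Proof.
move=> [df d2f] [dg d2g]; split=> [theta|s theta]; first exact: differentiableB.
have -> : partial s (f - g) = partial s f - partial s g.
  by apply/funext => z; rewrite /partial deriveB//; exact: diff_derivable.
exact: differentiableB.
Qed.

Section weighted_sums.
Variables (n : nat) (f : 'I_n -> V -> R) (w : 'I_n -> R).

Let sumE : (fun z => \sum_j f j z * w j) = \sum_j (w j \*: f j).
Proof.
by apply/funext => z; rewrite fct_sumE; apply: eq_bigr => j _; rewrite mulrC.
Qed.

Lemma differentiable_wsum theta : (forall j, differentiable (f j) theta) ->
  differentiable (fun z => \sum_j f j z * w j) theta.
Proof. by move=> df; rewrite sumE; apply: differentiable_sum => j; exact: differentiableZ. Qed.

Lemma derive_wsum theta v : (forall j, differentiable (f j) theta) ->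
  'D_v (fun z => \sum_j f j z * w j) theta = \sum_j 'D_v (f j) theta * w j.
Proof.
move=> df; have df' j : derivable (f j) theta v by exact: diff_derivable.
rewrite sumE derive_sum; last by move=> j; exact: derivableZ.
by apply: eq_bigr => j _; rewrite deriveZ// mulrC.
Qed.

End weighted_sums.

Lemma derive_ln (f : V -> R) theta v : 0 < f theta -> differentiable f theta ->
  'D_v (fun z => ln (f z)) theta = 'D_v f theta / f theta.
Proof.
move=> f0 df; have dln := is_derive1_ln f0.
by rewrite (@derive_comp _ _ f (@ln R)) ?derive_val// mulrC.
Qed.

Lemma differentiable_ln (f : V -> R) theta : 0 < f theta -> differentiable f theta ->
  differentiable (fun z => ln (f z)) theta.
Proof.
move=> f0 df; have dln := is_derive1_ln f0.
by apply: (differentiable_comp df); exact/derivable1_diffP.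
Qed.

Lemma partial_sum (n : nat) (f : 'I_n -> V -> R) s theta :
  (forall j, differentiable (f j) theta) ->
  partial s (fun z => \sum_j f j z) theta = \sum_j partial s (f j) theta.
Proof.
move=> df; rewrite /partial.
have -> : (fun z => \sum_j f j z) = (fun z => \sum_j f j z * 1).
  by apply/funext => z; apply: eq_bigr => j _; rewrite mulr1.
by rewrite derive_wsum//; apply: eq_bigr => j _; rewrite mulr1.
Qed.

Section log_mixture.
Variables (n : nat) (p : 'I_n -> V -> R) (w : 'I_n -> R).
Hypotheses (p_gt0 : forall theta, 0 < \sum_j p j theta * w j)
  (dp : forall j, twice_differentiable (p j)).
Let D z := \sum_j p j z * w j.
Let D_gt0 z : 0 < D z. Proof. exact: p_gt0. Qed.

Lemma partial_log_mixture t : partial t (fun z => ln (D z)) =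
  (fun z => (\sum_j partial t (p j) z * w j) / D z).
Proof.
apply/funext => z; rewrite /partial (@derive_ln D)//; last first.
  by apply: differentiable_wsum => j; exact: (dp j).1.
by congr (_ / _); apply: derive_wsum => j; exact: (dp j).1.
Qed.

Lemma differentiable_partial_log_mixture t theta :
  differentiable (partial t (fun z => ln (D z))) theta.
Proof.
rewrite partial_log_mixture; apply: differentiableM.
  by apply: differentiable_wsum => j; exact: (dp j).2.
apply: differentiableV; last by rewrite gt_eqF.
by apply: differentiable_wsum => j; exact: (dp j).1.
Qed.

(** The first derivative is a quotient of two weighted sums. The quotient rule yields second
    derivatives over [D] minus a product of two sums over the square of [D], which is expanded into
    a double sum. *)
Lemma hessian_log_mixture s t theta :
  partial s (partial t (fun z => ln (D z))) theta =
  \sum_j (partial s (partial t (p j)) theta * (w j / D theta) -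
    \sum_i partial s (p j) theta * partial t (p i) theta *
      (w j / D theta * (w i / D theta))).
Proof.
rewrite partial_log_mixture /partial.
have D0 : D theta != 0 by rewrite gt_eqF.
have dD : differentiable D theta by apply: differentiable_wsum => j; exact: (dp j).1.
have dN : differentiable (fun z => \sum_j partial t (p j) z * w j) theta.
  by apply: differentiable_wsum => j; exact: (dp j).2.
rewrite (@deriveM _ _ (fun z => \sum_j partial t (p j) z * w j) (fun z => (D z)^-1)); last 2 first.
- exact: diff_derivable.
- by apply: derivableV => //; exact: diff_derivable.
rewrite deriveV//; last exact: diff_derivable.
rewrite (@derive_wsum _ p) => [|j]; last exact: (dp j).1.
rewrite (@derive_wsum _ (fun j => partial t (p j))) => [|j]; last exact: (dp j).2.
rewrite /GRing.scale/= sumrB addrC; congr (_ + _).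
  by rewrite mulr_sumr; apply: eq_bigr => j _; rewrite mulrC -mulrA.
rewrite mulrCA mulNr [X in _ * X]mulrC mulr_suml mulr_sumr; congr (- _).
apply: eq_bigr => i _; rewrite !mulr_sumr; apply: eq_bigr => j _.
by rewrite /partial; field.
Qed.

End log_mixture.
End hessian.

(** * Law of the received vector *)

Section regions.
Context {R : realType} {alpha : nat}.
Variable tau : 'I_(2 ^ alpha).+1 -> \bar R.
Hypothesis htau : boundaries tau.
Implicit Types (j : 'I_(2 ^ alpha)) (r : R).

Lemma boundaries_lt j : (tau (widen_ord (leqnSn _) j) < tau (lift ord0 j))%E.
Proof. by case: htau => _ _; apply; rewrite lift0. Qed.

Lemma measurable_region j : measurable (region tau j).
Proof. exact: measurable_cell. Qed.

(** The region is indexed by the last boundary not exceeding [r]; this is not the final boundary,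
    which is infinite, so the index is admissible. *)
Lemma region_ex r : exists j, region tau j r.
Proof.
case: htau => t0 t1 _.
have P0 : (tau ord0 <= r%:E)%E by rewrite t0 leNye.
have [i Pi imax] := @arg_maxnP _ ord0 (fun i => (tau i <= r%:E)%E) (fun i => nat_of_ord i) P0.
have iM : (i < 2 ^ alpha)%N.
  rewrite ltn_neqAle -ltnS ltn_ord andbT; apply/eqP => iM.
  move: Pi; rewrite (_ : i = ord_max) ?t1 ?leye_eq//; exact: val_inj.
exists (Ordinal iM); rewrite /region /=; apply/andP; split.
  by rewrite (_ : widen_ord _ _ = i)//; exact: val_inj.
rewrite ltNge; apply/negP => /imax; rewrite lift0 /=.
by rewrite ltnn.
Qed.

(** For [i] below [j] the upper end of region [i] is at most the lower end of region [j], and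
    regions exclude their upper end. *)
Lemma region_inj i j r : region tau i r -> region tau j r -> i = j.
Proof.
wlog ij : i j / (i <= j)%N.
  move=> H; case/orP: (leq_total i j) => ij ri rj; first exact: H.
  by apply/esym; exact: H.
move=> /andP[_ ri] /andP[rj _]; apply/val_inj/eqP; rewrite eqn_leq ij /= leqNgt.
apply/negP => {}ij; case: htau => _ _ tm.
have : (tau (lift ord0 i) <= tau (widen_ord (leqnSn (2 ^ alpha)) j))%E.
  have [<-//|] := eqVneq (lift ord0 i) (widen_ord (leqnSn (2 ^ alpha)) j).
  rewrite -val_eqE => ne; apply/ltW/tm.
  by rewrite ltn_neqAle ne lift0 /=.
by move=> /(lt_le_trans ri) /lt_le_trans /(_ rj); rewrite ltxx.
Qed.

Lemma quantizeE (b : 'I_(2 ^ alpha) -> 'rV[R]_alpha) j r :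
  region tau j r -> quantize tau b r = b j.
Proof.
move=> rj; rewrite /quantize (bigD1 j)//= big1 ?addr0; last first.
  move=> i ij; rewrite indicE memNset ?scale0r// => ri.
  by move: ij; rewrite (region_inj ri rj) eqxx.
by rewrite indicE mem_set// scale1r.
Qed.

End regions.

Section sensor_law.
Context {R : realType} {alpha : nat}.
Context d (Omega : measurableType d) (P : probability Omega R).
Variables (W : {RV P >-> R}) (N : {RV P >-> alpha.-tuple R}).
Variables (m eta : R).
Hypothesis eta_gt0 : 0 < eta.
Variable tau : 'I_(2 ^ alpha).+1 -> \bar R.
Hypothesis htau : boundaries tau.
Variable b : 'I_(2 ^ alpha) -> 'rV[R]_alpha.
Hypothesis hN : forall A, measurable A -> P (N @^-1` A) =
  (\int[@tuple_lebesgue R alpha]_(z in A) (normal_vec_pdf eta z)%:E)%E.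
Hypothesis hWN : forall A B, measurable A -> measurable B ->
  P ((W @^-1` A) `&` (N @^-1` B)) = (P (W @^-1` A) * P (N @^-1` B))%E.

(** Noise values that place the observation in region [v] when the field equals [m]. *)
Let E v : set R := (fun w => w + m) @^-1` region tau v.

Let mE v : measurable (E v).
Proof.
rewrite /E -[X in measurable X]setTI.
by apply: measurable_funD => //; exact: measurable_region.
Qed.

(** The received vector moved to the space that carries the measurable structure, so that it has a
    law. *)
Definition received_tuple (omega : Omega) : alpha.-tuple R :=
  [tuple (quantize tau b (m + W omega) + rvec (N omega)) 0 r | r < alpha].

Lemma rvec_received_tuple omega :
  rvec (received_tuple omega) = quantize tau b (m + W omega) + rvec (N omega).
Proof. by apply/rowP => r; rewrite mxE tnth_mktuple. Qed.

Lemma received_tupleE v omega : region tau v (W omega + m) ->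
  received_tuple omega = tshift (fun r => b v 0%R r) (N omega).
Proof.
move=> rv; apply: eq_from_tnth => r.
by rewrite tnth_mktuple tnth_tshift [m + _]addrC (quantizeE htau _ rv) !mxE addrC.
Qed.

(** Within one region the received vector is the channel noise translated by a fixed label. The
    event thus splits into pieces, each an intersection of a [W]-event and an [N]-event, to which
    independence applies. *)
Lemma preimage_received_tuple A : received_tuple @^-1` A =
  \bigcup_v ((W @^-1` E v) `&` (N @^-1` (tshift (fun r => b v 0%R r) @^-1` A))).
Proof.
apply/seteqP; split => w /=.
  have [v rv] := region_ex htau (W w + m).
  by rewrite /preimage /= (received_tupleE rv) => Aw; exists v.
by move=> [v _ [rv Aw]]; rewrite /preimage /= (received_tupleE rv).
Qed.

Lemma measurable_received_tuple : measurable_fun setT received_tuple.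
Proof.
move=> _ A mA; rewrite setTI preimage_received_tuple.
apply: fin_bigcup_measurable => [|v _]; first exact: finite_finset.
apply: measurableI.
  by rewrite -[X in measurable X]setTI; exact: (measurable_funP W).
rewrite -[X in measurable X]setTI; apply: (measurable_funP N) => //.
by rewrite -[X in measurable X]setTI; exact: measurable_tshift.
Qed.

Definition received_pdf (z : alpha.-tuple R) : R :=
  \sum_v fine (P (W @^-1` E v)) *
    (expR (- sqn (rvec z - b v) / (2 * eta ^+ 2)) /
     (2 * pi * eta ^+ 2) `^ (alpha%:R / 2)).

Let gauss v (z : alpha.-tuple R) : R :=
  expR (- sqn (rvec z - b v) / (2 * eta ^+ 2)) /
     (2 * pi * eta ^+ 2) `^ (alpha%:R / 2).

Let gauss_ge0 v z : 0 <= gauss v z.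
Proof. by rewrite divr_ge0 ?expR_ge0 ?powR_ge0. Qed.

Let mgauss v : measurable_fun setT (gauss v).
Proof. by apply: measurable_funM => //; exact: measurable_expR_sqn. Qed.

Let integral_tshift_gauss v A : measurable A ->
  (\int[@tuple_lebesgue R alpha]_(z in tshift (fun r => b v 0%R r) @^-1` A)
     (normal_vec_pdf eta z)%:E =
   \int[@tuple_lebesgue R alpha]_(z in A) (gauss v z)%:E)%E.
Proof.
move=> mA; rewrite [LHS]integral_mkcond [RHS]integral_mkcond.
rewrite -[RHS](@ge0_integral_tshift _ _ (fun i => b v 0%R i)); last 2 first.
- by apply/(measurable_restrictT _ mA)/measurable_funTS/measurable_EFinP.
- by move=> x; apply: erestrict_ge0 => z _; rewrite lee_fin.
apply: eq_integral => z _; rewrite !patchE /gauss rvec_tshift addrK.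
by rewrite (_ : (tshift _ z \in A) = (z \in tshift (fun r => b v 0%R r) @^-1` A)).
Qed.

(** Additivity over the disjoint regions, independence on each piece, and translation of the noise
    density to the label of the region. *)
Lemma received_law A : measurable A -> P (received_tuple @^-1` A) =
  (\int[@tuple_lebesgue R alpha]_(z in A) (received_pdf z)%:E)%E.
Proof.
move=> mA.
have mt v : measurable (tshift (fun r => b v 0%R r) @^-1` A).
  by rewrite -[X in measurable X]setTI; exact: measurable_tshift.
rewrite preimage_received_tuple measure_fin_bigcup; last 3 first.
- exact: finite_finset.
- move=> i j _ _ [w [[/= ri _] [rj _]]]; exact: (region_inj htau ri rj).
- move=> v _; apply: measurableI; rewrite -[X in measurable X]setTI.
    exact: (measurable_funP W).
  exact: (measurable_funP N).
rewrite (fsbigE (index_enum 'I_(2 ^ alpha)) _ (index_enum_uniq _))//; last first.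
  by move=> v _; rewrite mem_index_enum.
rewrite (eq_bigl xpredT) => [|v]; last by rewrite in_setT.
transitivity (\sum_(v < 2 ^ alpha) (P (W @^-1` E v) *
    \int[@tuple_lebesgue R alpha]_(z in A) (gauss v z)%:E))%E.
  apply: eq_bigr => v _; rewrite -(integral_tshift_gauss v mA) -hN//.
  exact: hWN.
rewrite /received_pdf.
under [RHS]eq_integral do rewrite -sumEFin.
rewrite ge0_integral_sum//; last 2 first.
- move=> v; apply/measurable_EFinP/measurable_funTS/measurable_funM => //.
  exact: mgauss.
- by move=> v z _; rewrite lee_fin mulr_ge0 ?fine_ge0//; exact: gauss_ge0.
apply: eq_bigr => v _.
under [RHS]eq_integral do rewrite EFinM.
rewrite ge0_integralZl//; last 3 first.
- by apply/measurable_EFinP/measurable_funTS; exact: mgauss.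
- by move=> z _; rewrite lee_fin; exact: gauss_ge0.
- by rewrite lee_fin fine_ge0.
by rewrite fineK// fin_num_measure// -[X in measurable X]setTI; exact: (measurable_funP W).
Qed.

(** Total mass of the received law: the whole space has probability 1, and each Gaussian component
    integrates to 1. *)
Lemma sum_region_prob : \sum_v fine (P (W @^-1` E v)) = 1.
Proof.
have := received_law measurableT; rewrite preimage_setT probability_setT.
under eq_integral do rewrite -sumEFin.
rewrite ge0_integral_sum//; last 2 first.
- by move=> v; apply/measurable_EFinP/measurable_funM => //; exact: mgauss.
- by move=> v z _; rewrite lee_fin mulr_ge0 ?fine_ge0//; exact: gauss_ge0.
move=> H; apply: EFin_inj; rewrite H -sumEFin; apply: eq_bigr => v _.
under [RHS]eq_integral do rewrite EFinM.
rewrite ge0_integralZl//; last 3 first.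
- by apply/measurable_EFinP; exact: mgauss.
- by move=> z _; rewrite lee_fin; exact: gauss_ge0.
- by rewrite lee_fin fine_ge0.
by rewrite integral_gauss_vec// mule1.
Qed.

Lemma measurable_received_pdf : measurable_fun setT received_pdf.
Proof.
by apply: measurable_sum => v; apply: measurable_funM => //; exact: mgauss.
Qed.

Lemma received_pdf_ge0 z : 0 <= received_pdf z.
Proof.
by apply: sumr_ge0 => v _; rewrite mulr_ge0 ?fine_ge0//; exact: gauss_ge0.
Qed.

(** Expectations of functions of the received vector become integrals against its density. For
    nonnegative [h] a finite value already gives integrability. *)
Lemma has_mean_received (h : alpha.-tuple R -> R) (e : R) :
  measurable_fun setT h -> (forall z, 0 <= h z) ->
  (\int[@tuple_lebesgue R alpha]_z (h z * received_pdf z)%:E = e%:E)%E ->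
  has_mean P (h \o received_tuple) e.
Proof.
move=> mh h0 he; have mZ := measurable_received_tuple.
apply: ge0_has_mean; [exact: measurableT_comp mZ|by move=> w; exact: h0|].
rewrite -he.
have := @ge0_integral_pushforward _ _ _ _ R _ mZ P setT (EFin \o h) measurableT.
rewrite preimage_setT => <-//; last 2 first.
- exact/measurable_EFinP.
- by move=> z _; rewrite lee_fin.
rewrite (@ge0_integral_density _ _ _ (@tuple_lebesgue R alpha) _ received_pdf)//.
- exact: measurable_received_pdf.
- exact: received_pdf_ge0.
- exact: received_law.
- exact/measurable_EFinP.
Qed.

End sensor_law.

(** * The Gaussian integrals Lambda *)

Section complete_square.
Context {R : realType} {n : nat}.
Implicit Types (u v z : 'rV[R]_n) (c : R).

Lemma dotE u v : (u *m v^T) 0 0 = \sum_r u 0 r * v 0 r.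
Proof. by rewrite mxE; apply: eq_bigr => r _; rewrite mxE. Qed.

Lemma sqnB u v : sqn (u - v) = sqn u - 2 * (u *m v^T) 0 0 + sqn v.
Proof.
rewrite !sqnE mxE mulr_sumr -sumrB -big_split; apply: eq_bigr => i _ /=.
by rewrite !mxE; ring.
Qed.

Lemma sqnZ c u : sqn (c *: u) = c ^+ 2 * sqn u.
Proof. by rewrite !sqnE mulr_sumr; apply: eq_bigr => i _; rewrite mxE exprMn. Qed.

(** The points [b j], [b i] and [b v] carry weights 1, 1 and [l v] of total [N], and the weighted
    sum of squared distances is centred at their barycentre [S / N]. *)
Lemma complete_square (I : finType) (l : I -> nat) (b : I -> 'rV[R]_n) (j i : I) z :
  let S := b j + b i + \sum_v (l v)%:R *: b v in
  let Q := sqn (b j) + sqn (b i) + \sum_v (l v)%:R * sqn (b v) in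
  let N := (\sum_v l v + 2)%:R in
  sqn (z - b j) + sqn (z - b i) + \sum_v (l v)%:R * sqn (z - b v) =
  N * sqn (z - N^-1 *: S) + Q - sqn S / N.
Proof.
move=> S Q N; have N0 : N != 0 by rewrite pnatr_eq0 addn2.
have -> : \sum_v (l v)%:R * sqn (z - b v) = (N - 2) * sqn z -
    2 * (\sum_v (l v)%:R * (z *m (b v)^T) 0 0) + \sum_v (l v)%:R * sqn (b v).
  rewrite /N natrD addrK natr_sum mulr_suml mulr_sumr -sumrB -big_split.
  by apply: eq_bigr => v _ /=; rewrite sqnB; ring.
have zS : (z *m S^T) 0 0 = (z *m (b j)^T) 0 0 + (z *m (b i)^T) 0 0 +
    \sum_v (l v)%:R * (z *m (b v)^T) 0 0.
  under [in RHS]eq_bigr do rewrite dotE mulr_sumr.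
  rewrite !dotE exchange_big -!big_split/=; apply: eq_bigr => r _.
  rewrite !mxE summxE !mulrDr mulr_sumr; congr (_ + _).
  by apply: eq_bigr => v _; rewrite mxE; ring.
have zNS : (z *m (N^-1 *: S)^T) 0 0 = N^-1 * (z *m S^T) 0 0.
  by rewrite !dotE mulr_sumr; apply: eq_bigr => r _; rewrite mxE; ring.
rewrite !sqnB sqnZ zNS zS /Q.
by field.
Qed.

End complete_square.

Section Lambda.
Context {R : realType} {K alpha : nat}.
Variables (eta : 'I_K -> R) (b : 'I_(2 ^ alpha) -> 'rV[R]_alpha).
Hypothesis eta_gt0 : forall k, 0 < eta k.
Implicit Types (k : 'I_K) (i j v : 'I_(2 ^ alpha)) (l : 'I_(2 ^ alpha) -> nat).
Local Notation tl := (@tuple_lebesgue R alpha).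

(** After completing the square the integrand is a constant times a Gaussian density centred at
    [S / n]. The term [- sqn S / n] of the completed square changes sign in the exponent, hence a
    positive exponent in the first factor. *)
Lemma has_mean_Lambda k j i l :
  let S := b j + b i + \sum_v (l v)%:R *: b v in
  let Q := sqn (b j) + sqn (b i) + \sum_v (l v)%:R * sqn (b v) in
  let n := (\sum_v l v + 2)%N in
  has_mean tl (fun z => expR (- (sqn (rvec z - b j) + sqn (rvec z - b i)) / (2 * eta k ^+ 2)) /
       (2 * pi * eta k ^+ 2) `^ (alpha%:R / 2) *
     expR (- (1 / (2 * eta k ^+ 2)) *
           \sum_v (l v)%:R * sqn (rvec z - b v)))
  (expR (sqn S / (2 * eta k ^+ 2 * n%:R)) *
          (expR (- Q / (2 * eta k ^+ 2)) / Num.sqrt n%:R ^+ alpha)).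
Proof.
move=> S Q n.
have n0 : 0 < n%:R :> R by rewrite ltr0n /n addn2.
have e0 := eta_gt0 k.
(* The completed square has coefficient n / (2 eta^2) = 1 / (2 s^2). *)
set s := eta k / Num.sqrt n%:R.
have s0 : 0 < s by rewrite divr_gt0 ?sqrtr_gt0.
have s2 : s ^+ 2 = eta k ^+ 2 / n%:R by rewrite expr_div_n sqr_sqrtr// ltW.
have p0 : 0 < 2 * pi * s ^+ 2.
  by apply: mulr_gt0; [apply: mulr_gt0 => //; exact: pi_gt0|exact: exprn_gt0].
(* Replacing eta by [s] in the normalising constant costs n^(alpha/2), one factor sqrt n per
   coordinate. *)
have cE : (2 * pi * eta k ^+ 2) `^ (alpha%:R / 2) =
    (2 * pi * s ^+ 2) `^ (alpha%:R / 2) * Num.sqrt n%:R ^+ alpha.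
  have -> : 2 * pi * eta k ^+ 2 = 2 * pi * s ^+ 2 * n%:R.
    by rewrite s2; field; rewrite gt_eqF.
  rewrite powRM ?(ltW n0) ?(ltW p0)//; congr (_ * _).
  by rewrite [alpha%:R / 2]mulrC powRrM powR12_sqrt ?(ltW n0)// powR_mulrn ?sqrtr_ge0.
have c0 : (2 * pi * s ^+ 2) `^ (alpha%:R / 2) != 0.
  by rewrite gt_eqF// powR_gt0.
have r0 : Num.sqrt n%:R ^+ alpha != 0 :> R by rewrite gt_eqF// exprn_gt0// sqrtr_gt0.
have mG := integral_gauss_vec (n%:R^-1 *: S) s0.
have {}mG := ge0_has_mean _ _ mG.
have {}mG := has_meanZ (expR (sqn S / (2 * eta k ^+ 2 * n%:R)) *
          (expR (- Q / (2 * eta k ^+ 2)) / Num.sqrt n%:R ^+ alpha)) (mG _ _).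
rewrite mulr1 in mG; apply: eq_has_mean (mG _ _); last 2 first.
- by apply: measurable_funM => //; exact: measurable_expR_sqn.
- by move=> z; rewrite divr_ge0 ?expR_ge0 ?powR_ge0.
move=> z /=; rewrite cE.
set E1 := expR _; set E2 := expR _; set E3 := expR _; set E4 := expR _; set E5 := expR _.
have -> : E1 * (E2 / Num.sqrt n%:R ^+ alpha) *
  (E3 / (2 * pi * s ^+ 2) `^ (alpha%:R / 2)) =
  (E1 * E2 * E3) / ((2 * pi * s ^+ 2) `^ (alpha%:R / 2) * Num.sqrt n%:R ^+ alpha).
  by field; rewrite c0 r0.
rewrite [RHS]mulrAC; congr (_ / _).
rewrite /E1 /E2 /E3 /E4 /E5 -!expRD; congr expR.
have := complete_square l b j i (rvec z); rewrite -/S -/Q -/n /= => H.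
have -> : - (sqn (rvec z - b j) + sqn (rvec z - b i)) / (2 * eta k ^+ 2) +
  - (1 / (2 * eta k ^+ 2)) * (\sum_v (l v)%:R * sqn (rvec z - b v)) =
  - (sqn (rvec z - b j) + sqn (rvec z - b i) + \sum_v (l v)%:R * sqn (rvec z - b v)) / (2 * eta k ^+ 2).
  by field; rewrite gt_eqF.
rewrite H s2.
by field; rewrite !gt_eqF.
Qed.

Lemma LambdaE k j i l :
  let S := b j + b i + \sum_v (l v)%:R *: b v in
  let Q := sqn (b j) + sqn (b i) + \sum_v (l v)%:R * sqn (b v) in
  let n := (\sum_v l v + 2)%N in
  Lambda eta b k j i l = expR (sqn S / (2 * eta k ^+ 2 * n%:R)) *
          (expR (- Q / (2 * eta k ^+ 2)) / Num.sqrt n%:R ^+ alpha).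
Proof. by move=> S Q n; rewrite /Lambda /Rintegral (has_mean_Lambda k j i l).2. Qed.

End Lambda.

(** * The outer series *)

Section cell_prob.
Context {R : realType} {K alpha L : nat}.
Variables (g : 'I_K -> 'rV[R]_L -> R) (sigma : 'I_K -> R).
Hypothesis sigma_gt0 : forall k, 0 < sigma k.
Variable tau : 'I_(2 ^ alpha).+1 -> \bar R.
Hypothesis htau : boundaries tau.
Implicit Types (theta : 'rV[R]_L) (k : 'I_K) (j : 'I_(2 ^ alpha)).

Lemma cell_prob_gt0 k j theta : 0 < cell_prob g sigma tau k j theta.
Proof. by apply: normal_prob_cell_gt0; [rewrite gt_eqF|exact: boundaries_lt]. Qed.

(** A cell probability is a difference of two normal distribution functions of the mean, evaluated
    at the field value. *)
Lemma twice_differentiable_cell_prob k j : twice_differentiable (g k) ->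
  twice_differentiable (cell_prob g sigma tau k j).
Proof.
move=> dg; have s0 : sigma k != 0 by rewrite gt_eqF.
have -> : cell_prob g sigma tau k j =
    (ncdf (sigma k) (tau (lift ord0 j)) \o g k) -
    (ncdf (sigma k) (tau (widen_ord (leqnSn _) j)) \o g k).
  apply/funext => theta; apply: normal_prob_cell; exact/ltW/boundaries_lt.
have dn c := derivable_ncdf c s0.
apply: twice_differentiableB; apply: twice_differentiable_comp => //.
- exact: (dn _).1.
- exact: (dn _).2.
- exact: (dn _).1.
- exact: (dn _).2.
Qed.

Lemma cell_probE d (Omega : measurableType d) (P : probability Omega R)
    (W : {RV P >-> R}) k j theta :
  (forall A : set R, measurable A -> P (W @^-1` A) = normal_prob 0 (sigma k) A) ->
  fine (P (W @^-1` ((fun w => w + g k theta) @^-1` region tau j))) =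
  cell_prob g sigma tau k j theta.
Proof.
move=> hW; rewrite hW; last first.
  rewrite -[X in measurable X]setTI.
  by apply: measurable_funD => //; exact: measurable_region.
by rewrite normal_prob_shift ?gt_eqF//; exact: measurable_region.
Qed.

End cell_prob.

(** * Term-by-term integration of the geometric expansion of 1/D *)

Section outer_series.
Context {R : realType} {K alpha L : nat}.
Variables (g : 'I_K -> 'rV[R]_L -> R) (sigma eta : 'I_K -> R).
Hypotheses (sigma_gt0 : forall k, 0 < sigma k) (eta_gt0 : forall k, 0 < eta k).
Variable tau : 'I_(2 ^ alpha).+1 -> \bar R.
Hypothesis htau : boundaries tau.
Variable b : 'I_(2 ^ alpha) -> 'rV[R]_alpha.
Variables (k : 'I_K) (theta : 'rV[R]_L).
Local Notation tl := (@tuple_lebesgue R alpha).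
Let p j := cell_prob g sigma tau k j theta.
Hypothesis sum_p : \sum_j p j = 1.

Let w j (z : alpha.-tuple R) : R := expR (- sqn (rvec z - b j) / (2 * eta k ^+ 2)).
Let c : R := (2 * pi * eta k ^+ 2) `^ (alpha%:R / 2).
Let D z := \sum_v p v * w v z.

Let e2 : 0 < 2 * eta k ^+ 2. Proof. by rewrite mulr_gt0// exprn_gt0. Qed.

Let c_gt0 : 0 < c.
Proof.
apply: powR_gt0; rewrite mulrAC mulr_gt0//; exact: pi_gt0.
Qed.

Let p_gt0 j : 0 < p j. Proof. exact: cell_prob_gt0. Qed.

Let w_gt0 j z : 0 < w j z. Proof. exact: expR_gt0. Qed.

Let w_le1 j z : w j z <= 1.
Proof.
rewrite -expR0 ler_expR mulNr oppr_le0 divr_ge0 ?(ltW e2)// sqnE.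
by apply: sumr_ge0 => i _; exact: sqr_ge0.
Qed.

Let D_ge j z : p j * w j z <= D z.
Proof.
rewrite /D (bigD1 j)//= lerDl; apply: sumr_ge0 => i _.
by rewrite mulr_ge0 ?ltW.
Qed.

Lemma mixture_gt0 z : 0 < D z.
Proof.
(* At least one cell exists, and one positive summand suffices. *)
have j : 'I_(2 ^ alpha) by apply: (@Ordinal _ 0); rewrite expn_gt0.
by apply: lt_le_trans (D_ge j z); rewrite mulr_gt0.
Qed.

Let D_le1 z : D z <= 1.
Proof.
rewrite -sum_p; apply: ler_sum => v _; rewrite ler_piMr//; exact: ltW.
Qed.

Lemma has_mean_gauss j : has_mean tl (fun z => w j z / c) 1.
Proof.
apply: ge0_has_mean; last exact: integral_gauss_vec.
- by apply: measurable_funM => //; exact: measurable_expR_sqn.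
- by move=> z; rewrite divr_ge0 ?expR_ge0 ?(ltW c_gt0).
Qed.

(** Every monomial in the weights produced by the multinomial expansion merges with w_j w_i / c into
    the integrand of one [Lambda]; the sums are finite, so linearity suffices. *)
Lemma has_mean_series_term j i n : has_mean tl
  (fun z => w j z * w i z / c * (1 - D z) ^+ n)
  (series_term g sigma eta tau b theta k j i n).
Proof.
rewrite /series_term.
pose F (m : 'I_n.+1) (l : {ffun 'I_(2 ^ alpha) -> 'I_(n - m).+1}) z :=
  expR (- (sqn (rvec z - b j) + sqn (rvec z - b i)) / (2 * eta k ^+ 2)) / c *
     expR (- (1 / (2 * eta k ^+ 2)) *
           \sum_v (l v : nat)%:R * sqn (rvec z - b v)).
apply: (@eq_has_mean _ _ _ _ (fun z => \sum_(m < n.+1)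
   (-1) ^+ (m + n) * (n`!%:R / m`!%:R) *
    \sum_(l : {ffun 'I_(2 ^ alpha) -> 'I_(n - m).+1} | (\sum_v (l v : nat) == n - m)%N)
      ((\prod_v (p v ^+ l v / (l v)`!%:R)) * F m l z))); last first.
  apply: has_mean_sum => m; apply: has_meanZ; apply: has_mean_sum => l.
  apply: has_meanZ; rewrite LambdaE//; exact: has_mean_Lambda.
move=> z; rewrite /D expr_1B_multinomial mulr_sumr; apply: eq_bigr => m _.
rewrite [RHS]mulrCA; congr (_ * _); rewrite mulr_sumr; apply: eq_bigr => l _.
have -> : F m l z = w j z * w i z / c * \prod_v w v z ^+ l v.
  rewrite /F /w -expRD; congr (_ / _ * _).
    by congr expR; rewrite opprD mulrDl.
  under eq_bigr do rewrite -expRM_natl.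
  rewrite -expR_sum; congr expR; rewrite mulr_sumr; apply: eq_bigr => v _.
  by field; rewrite gt_eqF.
rewrite mulrCA; congr (_ * _); rewrite -big_split; apply: eq_bigr => v _ /=.
by rewrite exprMn mulrAC.
Qed.

Lemma cvg_outer_series j i : cvgn (series (series_term g sigma eta tau b theta k j i)) /\
  has_mean tl (fun z => w j z * w i z / (c * D z))
    (limn (series (series_term g sigma eta tau b theta k j i))).
Proof.
set u := series_term g sigma eta tau b theta k j i.
pose a z := w j z * w i z / c.
have a0 z : 0 <= a z by rewrite /a !mulr_ge0 ?ltW// invr_gt0.
have D0 := mixture_gt0.
(* Partial sums of a geometric series of ratio 1 - D; their limit is [h]. *)
pose f n z := series (geometric (a z) (1 - D z)) n.
pose h z := a z / D z.
have h0 z : 0 <= h z by rewrite /h divr_ge0// ltW.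
have mean_f n : has_mean tl (f n) (series u n).
  rewrite /f /series /= !big_mkord.
  apply: (@eq_has_mean _ _ _ _ (fun z => \sum_(m < n) a z * (1 - D z) ^+ m)).
    by move=> z; rewrite big_mkord.
  by apply: has_mean_sum => m; exact: has_mean_series_term.
have mean_G := has_meanZ (p j)^-1 (has_mean_gauss i).
have h_le z : h z <= (p j)^-1 * (w i z / c).
  rewrite /h /a ler_pdivrMr//.
  have -> : w j z * w i z / c = (p j)^-1 * (w i z / c) * (p j * w j z).
    by field; rewrite !gt_eqF.
  apply: ler_wpM2l => //.
  by rewrite !mulr_ge0 ?invr_ge0 ?ltW.
have f_le n z : `|f n z| <= (p j)^-1 * (w i z / c).
  rewrite ger0_norm; last first.
    by apply: sumr_ge0 => m _; rewrite mulr_ge0 ?exprn_ge0 ?subr_ge0.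
  (* The ratio lies in [0, 1[, so a partial sum a (1 - (1 - D)^n) / D is at most a / D. *)
  apply: le_trans (h_le z); rewrite /f geometric_seriesE; last first.
    by rewrite lt_eqF// ltrBlDr ltrDl.
  rewrite opprB addrCA subrr addr0 /h.
  apply: ler_wpM2r; first by rewrite invr_ge0 ltW.
  by rewrite ler_piMr// lerBlDr lerDl exprn_ge0 ?subr_ge0.
have f_h z : f n z @[n --> \oo] --> h z.
  rewrite /h -[X in _ / X](_ : 1 - (1 - D z) = D z); last by ring.
  apply: cvg_geometric_series.
  by rewrite ger0_norm ?subr_ge0// ltrBlDr ltrDl.
have mh : measurable_fun setT h.
  apply: (measurable_fun_cvg (h := f)) => [n|z _]; last exact: f_h.
  by apply/measurable_EFinP; exact: measurable_int (mean_f n).1.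
have ih : tl.-integrable setT (EFin \o h).
  apply: le_integrable mean_G.1 => //; first exact/measurable_EFinP.
  move=> z _ /=; rewrite lee_fin ger0_norm//.
  by rewrite ger0_norm//; exact: le_trans (h_le z).
have cv : (\int[tl]_z (f n z)%:E @[n --> \oo] --> \int[tl]_z (h z)%:E)%E.
  apply: (@dominated_cvg _ _ _ tl setT measurableT _ _
    (fun z => ((p j)^-1 * (w i z / c))%:E)).
  - by move=> n; exact: measurable_int (mean_f n).1.
  - by move=> z _; apply: cvg_EFin; [exact: nearW|exact: f_h].
  - by [].
  - exact: mean_G.1.
  - by move=> n z _; rewrite lee_fin.
have hE : (\int[tl]_z (h z)%:E = (\int[tl]_z h z)%:E)%E.
  by rewrite /Rintegral fineK// integrable_fin_num.
(* The integral of [f n] is the n-th partial sum of [u], so dominated convergence yields both the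
   convergence of the series and its limit. *)
have cu : series u @ \oo --> (\int[tl]_z h z)%R.
  move: cv; rewrite hE; under eq_fun do rewrite (mean_f _).2.
  by move=> /fine_cvgP[_].
split; first by apply/cvg_ex; eexists; exact: cu.
rewrite (cvg_lim _ cu)//.
apply: (@eq_has_mean _ _ _ _ h) => [z|]; last by split.
by rewrite /h /a; field; rewrite !gt_eqF.
Qed.

End outer_series.

(** * Fisher information *)

Lemma mutually_independent_pair d d1 d2 (T : measurableType d)
    (T1 : measurableType d1) (T2 : measurableType d2) (R : realType)
    (P : probability T R) (K : nat)
    (X : 'I_K -> {RV P >-> T1}) (Y : 'I_K -> {RV P >-> T2}) (k : 'I_K)
    (A : set T1) (B : set T2) :
  mutually_independent X Y -> measurable A -> measurable B ->
  P ((X k @^-1` A) `&` (Y k @^-1` B)) = (P (X k @^-1` A) * P (Y k @^-1` B))%E.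
Proof.
move=> indep mA mB.
pose A' i := if i == k then A else setT.
pose B' i := if i == k then B else setT.
have := indep A' B'.
have -> : \bigcap_i (X i @^-1` A' i) = X k @^-1` A.
  apply/seteqP; split => w /=; first by move=> /(_ k I); rewrite /preimage/= /A' eqxx.
  by move=> Aw i _; rewrite /preimage/= /A'; case: eqP => [->|].
have -> : \bigcap_i (Y i @^-1` B' i) = Y k @^-1` B.
  apply/seteqP; split => w /=; first by move=> /(_ k I); rewrite /preimage/= /B' eqxx.
  by move=> Aw i _; rewrite /preimage/= /B'; case: eqP => [->|].
move=> ->; last 2 first.
- by move=> i; rewrite /A'; case: ifP.
- by move=> i; rewrite /B'; case: ifP.
congr (_ * _)%E.
  rewrite (bigD1 k)//= big1 ?mule1 /A' ?eqxx// => i /negPf ->.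
  by rewrite preimage_setT probability_setT.
rewrite (bigD1 k)//= big1 ?mule1 /B' ?eqxx// => i /negPf ->.
by rewrite preimage_setT probability_setT.
Qed.

Section sensor_hessian.
Context {R : realType} {K alpha L : nat}.
Variables (g : 'I_K -> 'rV[R]_L -> R) (sigma eta : 'I_K -> R).
Hypothesis dg : forall k, twice_differentiable (g k).
Hypotheses (sigma_gt0 : forall k, 0 < sigma k) (eta_gt0 : forall k, 0 < eta k).
Variable tau : 'I_(2 ^ alpha).+1 -> \bar R.
Hypothesis htau : boundaries tau.
Variable b : 'I_(2 ^ alpha) -> 'rV[R]_alpha.
Context d (Omega : measurableType d) (P : probability Omega R).
Variables (W : 'I_K -> {RV P >-> R}) (N : 'I_K -> {RV P >-> alpha.-tuple R}).
Hypothesis hW : forall k (A : set R), measurable A ->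
  P (W k @^-1` A) = normal_prob 0 (sigma k) A.
Hypothesis hN : forall k (A : set (alpha.-tuple R)), measurable A ->
  P (N k @^-1` A) =
    (\int[@tuple_lebesgue R alpha]_(z in A) (normal_vec_pdf (eta k) z)%:E)%E.
Hypothesis hWN : mutually_independent W N.
Variable theta : 'rV[R]_L.
Local Notation p := (cell_prob g sigma tau).
Local Notation tl := (@tuple_lebesgue R alpha).

Lemma sum_cell_prob k : \sum_j p k j theta = 1.
Proof.
rewrite -(@sum_region_prob _ _ _ _ P (W k) (N k) (g k theta) (eta k) (eta_gt0 k)
  tau htau b (hN k)).
  by apply: eq_bigr => j _; rewrite (cell_probE g sigma_gt0 tau _ theta (hW k)).
by move=> A B; exact: mutually_independent_pair.
Qed.

Let w k j (z : alpha.-tuple R) : R := expR (- sqn (rvec z - b j) / (2 * eta k ^+ 2)).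
Let D k z := \sum_v p k v theta * w k v z.
Let c k : R := (2 * pi * eta k ^+ 2) `^ (alpha%:R / 2).
Let Z k := received_tuple (W k) (N k) (g k theta) tau b.

Let D_gt0 k z : 0 < D k z.
Proof. exact: mixture_gt0. Qed.

Let pdfE k z : received_pdf (W k) (g k theta) (eta k) tau b z = D k z / c k.
Proof.
rewrite /received_pdf mulr_suml; apply: eq_bigr => v _.
by rewrite (cell_probE g sigma_gt0 tau _ theta (hW k)) mulrA.
Qed.

Let mw k j : measurable_fun setT (w k j).
Proof. exact: measurable_expR_sqn. Qed.

Let mean_received k (h : alpha.-tuple R -> R) e :
  measurable_fun setT h -> (forall z, 0 <= h z) ->
  has_mean tl (fun z => h z * (D k z / c k)) e -> has_mean P (h \o Z k) e.
Proof.
move=> mh h0 [_ he].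
apply: (has_mean_received htau (hN k)) => //.
  by move=> A B; exact: mutually_independent_pair.
by under eq_integral do rewrite pdfE.
Qed.

Let mwD k j : measurable_fun setT (fun z => w k j z / D k z).
Proof.
(* As [D] is positive, its inverse is exp(- ln D), whose measurability follows by composition. *)
have -> : (fun z => w k j z / D k z) = (fun z => w k j z * expR (- ln (D k z))).
  by apply/funext => z; rewrite expRN lnK// posrE.
apply: measurable_funM => //; apply: measurableT_comp => //.
apply: measurableT_comp => //; apply: measurableT_comp; first exact: measurable_ln.
by apply: measurable_sum => v; exact: measurable_funM.
Qed.

Let wD_ge0 k j z : 0 <= w k j z / D k z.
Proof. by rewrite divr_ge0 ?expR_ge0// ltW. Qed.

Let mean1 k j : has_mean P (fun omega => w k j (Z k omega) / D k (Z k omega)) 1.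
Proof.
apply: (@mean_received k (fun z => w k j z / D k z)) => //.
(* The factor [D] of the density cancels the denominator and leaves a single Gaussian. *)
apply: eq_has_mean (has_mean_gauss eta_gt0 b k j) => z.
by rewrite mulrA divfK// gt_eqF.
Qed.

Let mean2 k j i : has_mean P
  (fun omega => w k j (Z k omega) / D k (Z k omega) *
     (w k i (Z k omega) / D k (Z k omega)))
  (limn (series (series_term g sigma eta tau b theta k j i))).
Proof.
apply: (@mean_received k (fun z => w k j z / D k z * (w k i z / D k z))) => [|z|].
- exact: measurable_funM.
- exact: mulr_ge0.
have [_ H] := cvg_outer_series sigma_gt0 eta_gt0 htau b (sum_cell_prob k) j i.
apply: eq_has_mean H => z.
have c0 : c k != 0.
  by rewrite gt_eqF// powR_gt0// mulrAC mulr_gt0 ?pi_gt0// mulr_gt0// exprn_gt0.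
by rewrite -/(w k j z) -/(w k i z) -/(D k z) -/(c k); field; rewrite c0 gt_eqF.
Qed.

Lemma loglik_hessianE s t omega :
  loglik_hessian g sigma eta tau b W N theta s t omega =
  \sum_k \sum_j
   (partial s (partial t (p k j)) theta * (w k j (Z k omega) / D k (Z k omega)) -
    \sum_i partial s (p k j) theta * partial t (p k i) theta *
      (w k j (Z k omega) / D k (Z k omega) * (w k i (Z k omega) / D k (Z k omega)))).
Proof.
have dp k j : twice_differentiable (p k j) by exact: twice_differentiable_cell_prob.
have D0 k z theta' : 0 < \sum_j p k j theta' * w k j z.
  exact: mixture_gt0.
rewrite /loglik_hessian /loglik.
pose f k th := ln (\sum_j p k j th * w k j (Z k omega)).
(* The data stay at [theta] while [th] is differentiated, so [th] enters only through the mixture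
   weights. *)
have -> : (fun th => \sum_k ln (\sum_j cell_prob g sigma tau k j th *
    expR (- sqn (received g tau b W N theta omega k - b j) / (2 * eta k ^+ 2)))) =
    (fun th => \sum_k f k th).
  apply/funext => th; apply: eq_bigr => k _; congr (ln _); apply: eq_bigr => j _.
  by rewrite /w /Z rvec_received_tuple.
have -> : partial t (fun th => \sum_k f k th) = (fun th => \sum_k partial t (f k) th).
  apply/funext => th; apply: partial_sum => k; apply: differentiable_ln => //.
  by apply: differentiable_wsum => j; exact: (dp k j).1.
rewrite partial_sum => [|k]; last exact: differentiable_partial_log_mixture.
by apply: eq_bigr => k _; exact: hessian_log_mixture.
Qed.

Lemma has_mean_loglik_hessian s t :
  has_mean P (loglik_hessian g sigma eta tau b W N theta s t)
  (\sum_k \sum_j (partial s (partial t (p k j)) theta -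
     \sum_i partial s (p k j) theta * partial t (p k i) theta *
       limn (series (series_term g sigma eta tau b theta k j i)))).
Proof.
apply: eq_has_mean; first by move=> omega; exact/esym/loglik_hessianE.
apply: has_mean_sum => k; apply: has_mean_sum => j; apply: has_meanB.
  by rewrite -[X in has_mean _ _ X]mulr1; exact: has_meanZ.
by apply: has_mean_sum => i; exact: has_meanZ.
Qed.

End sensor_hessian.

(** Integrability and convergence are part of the conclusion, so that the expectation and each
    [limn] are genuine values and not defaults. In [Lambda] the factor with [S] has a positive
    exponent, and the root is raised to the dimension alpha. *)
Theorem lemma4p1 (R : realType) (K alpha L : nat)
    (hK : (0 < K)%N) (halpha : (0 < alpha)%N) (hL : (0 < L)%N)
    (G : R -> R -> 'rV[R]_L -> R)
    (hG : forall x y, twice_differentiable (G x y))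
    (x y : 'I_K -> R)
    (sigma eta : 'I_K -> R)
    (hsigma : forall k, 0 < sigma k) (heta : forall k, 0 < eta k)
    (tau : 'I_(2 ^ alpha).+1 -> \bar R) (htau : boundaries tau)
    (b : 'I_(2 ^ alpha) -> 'rV[R]_alpha) (hb : bit_labels b)
    (d : measure_display) (Omega : measurableType d) (P : probability Omega R)
    (W : 'I_K -> {RV P >-> R}) (N : 'I_K -> {RV P >-> alpha.-tuple R})
    (hW : forall k (A : set R), measurable A ->
       P (W k @^-1` A) = normal_prob 0 (sigma k) A)
    (hN : forall k (A : set (alpha.-tuple R)), measurable A ->
       P (N k @^-1` A) =
         (\int[@tuple_lebesgue R alpha]_(z in A)
            (normal_vec_pdf (eta k) z)%:E)%E)
    (hWN : mutually_independent W N)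
    (theta : 'rV[R]_L) (s t : 'I_L) :
  let g k := G (x k) (y k) in
  let p := cell_prob g sigma tau in
  [/\ P.-integrable setT (EFin \o loglik_hessian g sigma eta tau b W N theta s t),
      forall k j i, cvgn (series (series_term g sigma eta tau b theta k j i)),
      fisher_information g sigma eta tau b W N theta s t =
        (- \sum_(k < K) \sum_(j < 2 ^ alpha)
            (partial s (partial t (p k j)) theta -
             \sum_(i < 2 ^ alpha)
               partial s (p k j) theta * partial t (p k i) theta *
               limn (series (series_term g sigma eta tau b theta k j i))))%:E &
      forall k j i (l : 'I_(2 ^ alpha) -> nat),
        let S := b j + b i + \sum_v (l v)%:R *: b v in
        let Q := sqn (b j) + sqn (b i) + \sum_v (l v)%:R * sqn (b v) in
        let n := (\sum_v l v + 2)%N in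
        Lambda eta b k j i l =
          expR (sqn S / (2 * eta k ^+ 2 * n%:R)) *
          (expR (- Q / (2 * eta k ^+ 2)) / Num.sqrt n%:R ^+ alpha)].
Proof.
move=> g p.
have dg k : twice_differentiable (g k) by exact: hG.
have [iH EH] := has_mean_loglik_hessian dg hsigma heta htau b hW hN hWN theta s t.
split => //.
- move=> k j i.
  by have [] := cvg_outer_series hsigma heta htau b
    (sum_cell_prob g hsigma heta htau b hW hN hWN theta k) j i.
- by rewrite /fisher_information unlock EH EFinN.
- by move=> k j i l; exact: LambdaE.
Qed.
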